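(* Let $p$ be a prime, $h>2$, and let $F(x,y)$ be the universal deformation of the height $h$ Honda formal group law defined in the context. Then, modulo $(u_1,\dots,u_{h-2},(x,y)^{p^{h}+1})$, $$F(x,y) = x +y -\frac{u_{h-1}}{1-p^{p^{h-1}-1}}C_{p^{h-1}}(x,y) - \frac{1}{1-p^{p^h-1}}C_{p^h}(x,y) +\sum_{m=1}^{p-1}u_{h-1}^{m+1}P_{m}(x,y),$$ where $$C_{p^n}(x,y) = \frac{1}{p}\left((x+y)^{p^n} - x^{p^n} -y^{p^n}\right)$$ and $$P_{m}(x,y) = \frac{1}{(p-p^{p^{h-1}})^{m+1}} \sum_{j=0}^{m} \frac{(-1)^{j+1}}{j+1}\binom{p^{h-1}(j+1)}{j} \binom{j(p^{h-1}-1)+p^{h-1}}{m-j}(x+y)^{p^{h-1}(j+1)-m}\left(x^{p^{h-1}} + y^{p^{h-1}}\right)^{m-j}.$$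
   Context: Let $\mathbb{W}=W(\mathbb{F}_{p^h})$ be the Witt vectors and $R=\mathbb{W}[[u_1,\dots,u_{h-1}]]$. Let $V=\mathbb{Z}_{(p)}[v_1,v_2,\dots]$ be the ring representing $p$-typical formal group laws over $\mathbb{Z}_{(p)}$-algebras, with universal $p$-typical formal group law $G$ whose logarithm is $\log_G(x)=\sum_{i\ge 0} l_i x^{p^i}$, $l_0=1$. The generators $v_i$ are the Araki generators, defined by $v_0=p$ and $p\,l_n=\sum_{0\le i\le n} l_i v_{n-i}^{p^i}$. Let $\phi:V\to R$ be the ring map with $\phi(v_i)=u_i$ for $1\le i\le h-1$, $\phi(v_h)=1$, $\phi(v_i)=0$ for $i>h$, and put $F(x,y)=\phi_*G(x,y)$, a formal group law over $R$. Equivalently $F(x,y)=\exp(\log(x)+\log(y))$, where $\log(x)=\sum_{i\ge0}\phi(l_i)x^{p^i}$ over $R\otimes\mathbb{Q}$ and $\exp$ is its compositional inverse. $F$ is a universal deformation to $R$ of the Honda formal group law of height $h$ over $\mathbb{F}_{p^h}$ (the unique $p$-typical formal group law over $\mathbb{F}_p$ with $p$-series $x^{p^h}$). *)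

(* Defs.v *)
From HB Require Import structures.
From mathcomp Require Import all_boot all_order all_algebra.
From mathcomp Require Import boolp.
From mathcomp Require Import monalg mpoly.

Set Implicit Arguments.
Unset Strict Implicit.
Unset Printing Implicit Defensive.

Import GRing.Theory Num.Theory.
Local Open Scope ring_scope.

Section Congruence.
Variable A : comNzRingType.
Implicit Types (a b c : A) (d : nat).

Definition eqm d a b := exists c, a - b = c *+ d.

Lemma eqm_refl d a : eqm d a a.
Proof. by exists 0; rewrite subrr mul0rn. Qed.

Lemma eqm_sym d a b : eqm d a b -> eqm d b a.
Proof. by case=> c e; exists (- c); rewrite mulNrn -e opprB. Qed.

Lemma eqm_trans d a b c : eqm d a b -> eqm d b c -> eqm d a c.
Proof.
by case=> u eu [v ev]; exists (u + v); rewrite mulrnDl -eu -ev addrA subrK.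
Qed.

Lemma eqmD d a b a' b' : eqm d a b -> eqm d a' b' -> eqm d (a + a') (b + b').
Proof.
by case=> u eu [v ev]; exists (u + v); rewrite mulrnDl -eu -ev opprD addrACA.
Qed.

Lemma eqmN d a b : eqm d a b -> eqm d (- a) (- b).
Proof. by case=> u eu; exists (- u); rewrite mulNrn -eu opprB opprK addrC. Qed.

Lemma eqmM d a b a' b' : eqm d a b -> eqm d a' b' -> eqm d (a * a') (b * b').
Proof.
case=> u eu [v ev]; exists (u * a' + b * v).
rewrite mulrnDl -mulrnAl -mulrnAr -eu -ev mulrBl mulrBr.
by rewrite addrA subrK.
Qed.

Lemma eqmX d a b n : eqm d a b -> eqm d (a ^+ n) (b ^+ n).
Proof.
by move=> e; elim: n => [|n IH]; rewrite ?expr0 ?exprS;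
  [apply: eqm_refl | apply: eqmM].
Qed.

Lemma eqm_sum d (I : Type) (r : seq I) (F G : I -> A) :
  (forall i, eqm d (F i) (G i)) -> eqm d (\sum_(i <- r) F i) (\sum_(i <- r) G i).
Proof.
move=> e; elim: r => [|i r IH]; first by rewrite !big_nil; apply: eqm_refl.
by rewrite !big_cons; apply: eqmD.
Qed.

Lemma eqmMn d k a b : eqm d a b -> eqm (k * d) (a *+ k) (b *+ k).
Proof. by case=> u eu; exists u; rewrite -mulrnBl eu -mulrnA mulnC. Qed.

Lemma eqm_lift (p k : nat) a b :
  eqm (p ^ k.+1) a b -> eqm (p ^ k.+2) (a ^+ p) (b ^+ p).
Proof.
move=> e; have: eqm p (\sum_(i < p) a ^+ (p.-1 - i) * b ^+ i) 0.
  have ep : eqm p a b.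
    by case: e => c e; exists (c *+ p ^ k); rewrite e expnSr mulrnA.
  have: eqm p (\sum_(i < p) a ^+ (p.-1 - i) * b ^+ i)
              (\sum_(i < p) b ^+ (p.-1)).
    apply: eqm_sum => i.
    have {2}-> : p.-1 = (p.-1 - i + i)%N.
      by rewrite subnK // -ltnS prednK ?ltn_ord // (leq_ltn_trans _ (ltn_ord i)).
    by rewrite exprD; apply: eqmM (eqm_refl _ _); apply: eqmX.
  rewrite sumr_const card_ord => e'; apply: eqm_trans e' _.
  by exists (b ^+ p.-1); rewrite subr0.
case: e => u eu [v]; rewrite subr0 => ev; exists (u * v).
have := subrXX a b p; rewrite eu => ->; rewrite ev.
by rewrite mulrnAl mulrnAr -mulrnA [in RHS]expnSr mulnC.
Qed.

Lemma eqm_liftX (p k : nat) a b :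
  eqm p a b -> eqm (p ^ k.+1) (a ^+ (p ^ k)) (b ^+ (p ^ k)).
Proof.
move=> e; elim: k => [|k IH]; first by rewrite expn0 expn1.
have -> : (p ^ k.+1 = p ^ k * p)%N by rewrite expnSr.
by rewrite !exprM; apply: eqm_lift.
Qed.

Lemma eqm_exprD (p : nat) a b : prime p -> eqm p ((a + b) ^+ p) (a ^+ p + b ^+ p).
Proof.
move=> pp; rewrite exprDn.
have [n en] : exists n, p = n.+1 by exists p.-1; rewrite prednK ?prime_gt0.
rewrite en big_ord_recr big_ord_recl /= -en subn0 subnn !expr0 mul1r mulr1.
rewrite bin0 binn !mulr1n -addrA addrC -addrA [b ^+ p + _]addrC -[X in eqm _ _ X]add0r.
apply: eqmD (eqm_refl _ _).
rewrite [X in eqm _ _ X](_ : 0 = \sum_(i < n) (0 : A)); last by rewrite big1.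
apply: eqm_sum => i.
have /dvdnP[c ->] : (p %| 'C(p, bump 0 i))%N.
  by apply: prime_dvd_bin => //; rewrite en /bump /= add1n ltnS ltn_ord.
by rewrite mulrnA; eexists; rewrite subr0.
Qed.

End Congruence.

Lemma eqm_fermat (p : nat) (c : int) : prime p -> eqm p (c ^+ p) c.
Proof.
move=> pp; have p0 := prime_gt0 pp.
have nn (n : nat) : eqm p (n%:Z ^+ p) n%:Z.
  elim: n => [|n IH]; first by rewrite expr0n gtn_eqF //; exact: (eqm_refl p (0 : int)).
  rewrite -addn1 PoszD; apply: eqm_trans (eqm_exprD _ _ pp) _.
  by rewrite expr1n; apply: eqmD (eqm_refl _ _).
case: c => n; first exact: nn.
rewrite NegzE; move: (n.+1) => {}n.
have := eqm_exprD n%:Z (- n%:Z) pp.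
rewrite subrr expr0n gtn_eqF //= => e.
rewrite -[X in eqm _ X _](addKr (n%:Z ^+ p)) -[X in eqm _ _ X]addr0.
by apply: eqmD; [apply/eqmN/nn | apply: eqm_sym].
Qed.

Section Ghost.
Variables (p : nat) (A : comNzRingType).

Definition ghost (n : nat) (a : nat -> A) : A :=
  \sum_(i < n.+1) a i ^+ (p ^ (n - i)) *+ p ^ i.

End Ghost.

Lemma rmorph_ghost p (A B : comNzRingType) (f : {rmorphism A -> B}) n a :
  f (ghost p n a) = ghost p n (f \o a).
Proof.
by rewrite rmorph_sum; apply: eq_bigr => i _; rewrite rmorphMn rmorphXn.
Qed.

Lemma eq_ghost p (A : comNzRingType) n (a b : nat -> A) :
  (forall i, (i <= n)%N -> a i = b i) -> ghost p n a = ghost p n b.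
Proof. by move=> e; apply: eq_bigr => i _; rewrite e // -ltnS. Qed.

Section Unghost.
Variables (p : nat) (A : comNzRingType) (quo : nat -> A -> A).
Implicit Types (w : nat -> A).

(* The i-th component is p^-i (w_i - \sum_(j < i) p^j a_j^(p^(i-j))); here quo d
   divides by d, and the divisions are exact when w is in the image of the
   ghost map *)
Fixpoint unghost_seq w n : seq A :=
  if n is n'.+1 then
    let s := unghost_seq w n' in
    rcons s (quo (p ^ n')
               (w n' - \sum_(i < n') s`_i ^+ (p ^ (n' - i)) *+ p ^ i))
  else [::].

Definition unghost w n : A := (unghost_seq w n.+1)`_n.

Lemma size_unghost_seq w n : size (unghost_seq w n) = n.
Proof. by elim: n => //= n IH; rewrite size_rcons IH. Qed.

Lemma unghost_seqE w n i : (i < n)%N -> (unghost_seq w n)`_i = unghost w i.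
Proof.
elim: n => // n IH; rewrite ltnS leq_eqVlt => /orP[/eqP-> //|lt_in].
by rewrite /= nth_rcons size_unghost_seq lt_in IH.
Qed.

Lemma unghostE w n :
  unghost w n = quo (p ^ n)
    (w n - \sum_(i < n) unghost w i ^+ (p ^ (n - i)) *+ p ^ i).
Proof.
rewrite {1}/unghost /= nth_rcons size_unghost_seq ltnn eqxx.
by congr (quo _ (_ - _)); apply: eq_bigr => i _; rewrite unghost_seqE.
Qed.

Variable phi : {rmorphism A -> A}.
Hypothesis pp : prime p.
Hypothesis quoK : forall d a, (0 < d)%N -> quo d (a *+ d) = a.
Hypothesis phiP : forall a, eqm p (phi a) (a ^+ p).

Lemma phi_ghost n a : eqm (p ^ n.+1) (phi (ghost p n a)) (ghost p n.+1 a).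
Proof.
rewrite rmorph_ghost /ghost [in X in eqm _ _ X]big_ord_recr /= subnn expr1.
rewrite -[X in eqm _ X _]addr0; apply: eqmD; last first.
  by apply: eqm_sym; eexists; rewrite subr0.
apply: eqm_sum => i.
have le_in : (i <= n)%N by rewrite -ltnS.
have -> : (p ^ n.+1 = p ^ i * p ^ (n - i).+1)%N by rewrite -expnD addnS subnKC.
apply: eqmMn; rewrite subSn // [X in eqm _ _ (_ ^+ X)]expnS exprM.
by apply: eqm_liftX; apply: phiP.
Qed.

Lemma dwork w : (forall n, eqm (p ^ n.+1) (w n.+1) (phi (w n))) ->
  forall n, ghost p n (unghost w) = w n.
Proof.
move=> cw; have pn n : (0 < p ^ n)%N by rewrite expn_gt0 prime_gt0.
elim=> [|n IH].
  by rewrite /ghost big_ord1 unghostE big_ord0 subr0 expr1 -[w 0%N]mulr1n quoK.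
rewrite /ghost big_ord_recr /= subnn expr1 (unghostE w n.+1).
set S := \sum_(i < n.+1) _.
have [c ec] : eqm (p ^ n.+1) (w n.+1) S.
  apply: eqm_trans (cw n) _; rewrite -IH; apply: eqm_trans (phi_ghost _ _) _.
  rewrite /ghost big_ord_recr /= -/S -[X in eqm _ _ X]addr0.
  by apply: eqmD (eqm_refl _ _) _; eexists; rewrite subr0.
by rewrite ec quoK // -ec addrC subrK.
Qed.

End Unghost.

Section MpolyInt.
Variables (p N : nat).
Let M : comNzRingType := mpoly N int.
Implicit Types (f g : M).

Definition mpoly_quo (d : nat) f : M := \sum_(m <- msupp f) (f@_m %/ d)%Z *: 'X_[m].

Lemma mpoly_quoK d f : (0 < d)%N -> mpoly_quo d (f *+ d) = f.
Proof.
move=> d0; rewrite /mpoly_quo [RHS]mpolyE.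
have e : perm_eq (msupp (f *+ d)) (msupp f).
  apply: uniq_perm => // m; rewrite !mcoeff_msupp mcoeffMn.
  by rewrite -mulr_natr mulf_eq0 (pnatr_eq0 int) negb_or -(lt0n d) d0 andbT.
rewrite (perm_big _ e) /=; apply: eq_bigr => m _; congr (_ *: _).
rewrite mcoeffMn -mulr_natr natz mulzK //.
by rewrite -lt0n in d0 *.
Qed.

Lemma mpoly_mulrI d f g : (0 < d)%N -> f *+ d = g *+ d -> f = g.
Proof. by move=> d0 e; rewrite -(mpoly_quoK f d0) e mpoly_quoK. Qed.

Hypothesis pp : prime p.

Definition frob f : M := mmap (@mpolyC N int) (fun i => 'X_i ^+ p) f.
HB.instance Definition _ := GRing.RMorphism.copy frob (mmap (@mpolyC N int) (fun i => 'X_i ^+ p)).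

Lemma frobP f : eqm p (frob f) (f ^+ p).
Proof.
elim/mpolyind: f => [|c m f _ _ IH].
  by rewrite rmorph0 expr0n -(prednK (prime_gt0 pp)) /=; apply: eqm_refl.
rewrite rmorphD; apply: eqm_trans (eqm_sym (eqm_exprD _ _ pp)).
apply: eqmD; last exact: IH.
rewrite -mul_mpolyC rmorphM exprMn /=.
have -> : frob c%:MP = c%:MP by rewrite /frob mmapC.
have -> : frob 'X_[m] = 'X_[m] ^+ p.
  rewrite /frob mmapX /mmap1 mpolyXE_id -prodrXl.
  by apply: eq_bigr => i _; rewrite -!exprM mulnC.
apply: eqmM (eqm_refl _ _); rewrite -(rmorphXn (@mpolyC N int)) /=; apply: eqm_sym.
by case: (eqm_fermat c pp) => u eu; exists u%:MP; rewrite -mpolyCB eu mpolyCMn.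
Qed.

Lemma mpoly_dwork (w : nat -> M) :
  (forall n, eqm (p ^ n.+1) (w n.+1) (frob (w n))) ->
  forall n, ghost p n (unghost p mpoly_quo w) = w n.
Proof. exact: (@dwork p M mpoly_quo frob pp mpoly_quoK frobP). Qed.

Lemma frob_ghost n (a : nat -> M) :
  eqm (p ^ n.+1) (frob (ghost p n a)) (ghost p n.+1 a).
Proof. exact: (@phi_ghost p M frob frobP). Qed.

End MpolyInt.

Section TwoVar.
Variable A : comNzRingType.

Definition ev2 (a b : A) (Phi : mpoly 2 int) : A :=
  mmap intr (fun i : 'I_2 => if i == ord0 then a else b) Phi.

End TwoVar.

Lemma rmorph_ev2 (A B : comNzRingType) (f : {rmorphism A -> B}) a b Phi :
  f (ev2 a b Phi) = ev2 (f a) (f b) Phi.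
Proof.
rewrite /ev2 /mmap rmorph_sum; apply: eq_bigr => m _.
rewrite rmorphM rmorph_int /mmap1 rmorph_prod; congr (_ * _).
by apply: eq_bigr => i _; rewrite rmorphXn; case: ifP.
Qed.

Section Generic.
Variables (J : finType) (n : nat).

Definition gpoly : comNzRingType := {mpoly int[#|{: J * 'I_n.+1}|]}.

Definition gvar (j : J) (i : nat) : gpoly := 'X_(enum_rank (j, inord i : 'I_n.+1)).

Definition geval (A : comNzRingType) (v : J -> nat -> A) (f : gpoly) : A :=
  mmap intr (fun k => let ji : J * 'I_n.+1 := enum_val k in v ji.1 ji.2) f.

HB.instance Definition _ (A : comNzRingType) v :=
  GRing.RMorphism.copy (@geval A v)
    (mmap intr (fun k => let ji : J * 'I_n.+1 := enum_val k in v ji.1 ji.2)).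

Lemma geval_gvar (A : comNzRingType) (v : J -> nat -> A) j i :
  (i <= n)%N -> geval v (gvar j i) = v j i.
Proof.
move=> le_in; rewrite /geval /gvar mmapX mmap1U enum_rankK /=.
by rewrite inordK.
Qed.

Lemma eq_geval (A : comNzRingType) (v w : J -> nat -> A) f :
  (forall j i, (i <= n)%N -> v j i = w j i) -> geval v f = geval w f.
Proof.
move=> e; rewrite /geval /mmap; apply: eq_bigr => m _; congr (_ * _).
by apply: eq_bigr => k _; rewrite e // -ltnS.
Qed.

Lemma rmorph_geval (A B : comNzRingType) (g : {rmorphism A -> B}) v f :
  g (geval v f) = geval (fun j => g \o v j) f.
Proof.
rewrite /geval /mmap rmorph_sum; apply: eq_bigr => m _.
rewrite rmorphM rmorph_int /mmap1 rmorph_prod; congr (_ * _).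
by apply: eq_bigr => i _; rewrite rmorphXn.
Qed.

Lemma gpoly_mulrI d (f g : gpoly) : (0 < d)%N -> f *+ d = g *+ d -> f = g.
Proof. exact: mpoly_mulrI. Qed.

End Generic.

Section WittPolynomials.
Variables (p : nat) (pp : prime p).

Definition torsion_free (A : comNzRingType) :=
  forall d (a b : A), (0 < d)%N -> a *+ d = b *+ d -> a = b.

Lemma ghost_inj (A : comNzRingType) n (a b : nat -> A) : torsion_free A ->
  (forall m, (m <= n)%N -> ghost p m a = ghost p m b) -> a n = b n.
Proof.
move=> tf; elim/ltn_ind: n => n IH e.
have := e n (leqnn n); rewrite /ghost !big_ord_recr /= subnn !expr1.
rewrite (eq_bigr (fun i : 'I_n => b i ^+ (p ^ (n - i)) *+ p ^ i)).
  by move/addrI; apply: tf; rewrite expn_gt0 prime_gt0.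
move=> i _; rewrite (IH i) // => m le_mi; apply: e.
by apply: leq_trans le_mi _; apply: ltnW.
Qed.

(* The n-th Witt polynomial attached to Phi, in the variables X_i = gvar false i
   and Y_i = gvar true i: the sequence of these polynomials is characterized by
   ghost p n (witt_op Phi X Y) = Phi(ghost p n X, ghost p n Y), see ghost_op *)
Definition witt_poly_seq (Phi : mpoly 2 int) n : nat -> gpoly bool n :=
  unghost p (@mpoly_quo _) (fun m => ev2 (ghost p m (gvar n false)) (ghost p m (gvar n true)) Phi).

Definition witt_poly Phi n : gpoly bool n := witt_poly_seq Phi n n.

Definition witt_op (A : comNzRingType) Phi (x y : nat -> A) (n : nat) : A :=
  geval (fun j : bool => if j then y else x) (witt_poly Phi n).

Lemma ghost_witt_poly_seq Phi n m :
  ghost p m (witt_poly_seq Phi n) =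
    ev2 (ghost p m (gvar n false)) (ghost p m (gvar n true)) Phi.
Proof.
apply: (mpoly_dwork pp) => {}m; rewrite rmorph_ev2.
have ge j : eqm (p ^ m.+1) (ghost p m.+1 (gvar n j)) (frob p (ghost p m (gvar n j))).
  by apply: eqm_sym; apply: frob_ghost.
rewrite /ev2 /mmap; apply: eqm_sum => k; apply: eqmM (eqm_refl _ _) _.
rewrite /mmap1; elim: (index_enum _) => [|i r IH].
  by rewrite !big_nil; apply: eqm_refl.
by rewrite !big_cons; apply: eqmM; [apply: eqmX; case: ifP => _; exact: ge | exact: IH].
Qed.

Lemma witt_op_eq (A : comNzRingType) Phi (x y x' y' : nat -> A) n :
  (forall i, (i <= n)%N -> x i = x' i) -> (forall i, (i <= n)%N -> y i = y' i) ->
  witt_op Phi x y n = witt_op Phi x' y' n.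
Proof. by move=> ex ey; apply: eq_geval => -[] i le_in; [apply: ey|apply: ex]. Qed.

Lemma rmorph_witt_op (A B : comNzRingType) (f : {rmorphism A -> B}) Phi x y n :
  f (witt_op Phi x y n) = witt_op Phi (f \o x) (f \o y) n.
Proof. by rewrite rmorph_geval; apply: eq_geval => -[]. Qed.

Lemma geval_ghost (A : comNzRingType) (J : finType) k m (v : J -> nat -> A) j : (m <= k)%N ->
  geval v (ghost p m (gvar k j)) = ghost p m (v j).
Proof.
move=> le_mk; rewrite (rmorph_ghost p (geval v)); apply: eq_ghost => i le_im.
exact: geval_gvar (leq_trans le_im le_mk).
Qed.

Lemma ghost_op (A : comNzRingType) Phi (x y : nat -> A) n : torsion_free A ->
  ghost p n (witt_op Phi x y) = ev2 (ghost p n x) (ghost p n y) Phi.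
Proof.
move=> tf; pose v j := if j : bool then y else x.
have gv k m : (m <= k)%N -> ghost p m (geval v \o witt_poly_seq Phi k) =
    ev2 (ghost p m x) (ghost p m y) Phi.
  move=> le_mk; rewrite -(rmorph_ghost p (geval v)) ghost_witt_poly_seq.
  rewrite (rmorph_ev2 (geval v)); congr (ev2 _ _ _).
    exact: (geval_ghost v false le_mk).
  exact: (geval_ghost v true le_mk).
rewrite -(gv n n) //; apply: eq_ghost => i le_in.
apply: (@ghost_inj _ i (geval v \o witt_poly_seq Phi i)) => // m le_mi.
by rewrite !gv // (leq_trans le_mi).
Qed.

End WittPolynomials.

(* p-typical Witt vectors *)
Record witt (p : nat) (pp : prime p) (A : Type) := Witt { wcoord : nat -> A }.

HB.instance Definition _ p pp A := gen_eqMixin (@witt p pp A).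
HB.instance Definition _ p pp A := gen_choiceMixin (@witt p pp A).

Section WittRing.
Variables (p : nat) (pp : prime p) (A : comNzRingType).
Local Notation W := (witt pp A).

Lemma wittP (x y : W) : wcoord x =1 wcoord y -> x = y.
Proof. by case: x y => [x] [y] /= /funext->. Qed.

Definition wzero : W := Witt pp (fun=> 0).
Definition wone : W := Witt pp (fun n => (n == 0%N)%:R).
Definition wadd (x y : W) : W :=
  Witt pp (witt_op p ('X_ord0 + 'X_ord_max) (wcoord x) (wcoord y)).
Definition wopp (x : W) : W :=
  Witt pp (witt_op p (- 'X_ord0) (wcoord x) (wcoord x)).
Definition wmul (x y : W) : W :=
  Witt pp (witt_op p ('X_ord0 * 'X_ord_max) (wcoord x) (wcoord y)).

End WittRing.

Section WittLaws.
Variables (p : nat) (pp : prime p).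

Definition wmap (A B : comNzRingType) (f : A -> B) (x : witt pp A) : witt pp B :=
  Witt pp (f \o wcoord x).

Definition wagree (A : comNzRingType) n (x y : witt pp A) :=
  forall i, (i <= n)%N -> wcoord x i = wcoord y i.

Lemma wmap_add (A B : comNzRingType) (f : {rmorphism A -> B}) x y :
  wmap f (wadd x y) = wadd (wmap f x) (wmap f y).
Proof. by apply: wittP => i; rewrite /= rmorph_witt_op. Qed.
Lemma wmap_mul (A B : comNzRingType) (f : {rmorphism A -> B}) x y :
  wmap f (wmul x y) = wmul (wmap f x) (wmap f y).
Proof. by apply: wittP => i; rewrite /= rmorph_witt_op. Qed.
Lemma wmap_opp (A B : comNzRingType) (f : {rmorphism A -> B}) x :
  wmap f (wopp x) = wopp (wmap f x).
Proof. by apply: wittP => i; rewrite /= rmorph_witt_op. Qed.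
Lemma wmap_one (A B : comNzRingType) (f : {rmorphism A -> B}) :
  wmap f (wone pp A) = wone pp B.
Proof. by apply: wittP => i; rewrite /= rmorph_nat. Qed.
Lemma wmap_zero (A B : comNzRingType) (f : {rmorphism A -> B}) :
  wmap f (wzero pp A) = wzero pp B.
Proof. by apply: wittP => i; rewrite /= rmorph0. Qed.

Section Ghosts.
Variable A : comNzRingType.
Hypothesis tf : torsion_free A.
Let gh n (x : witt pp A) := ghost p n (wcoord x).

Lemma ghX (x y : A) : ev2 x y 'X_ord0 = x.
Proof. by rewrite /ev2 mmapX mmap1U eqxx. Qed.
Lemma ghY (x y : A) : ev2 x y 'X_ord_max = y.
Proof. by rewrite /ev2 mmapX mmap1U. Qed.

Lemma gh_add n x y : gh n (wadd x y) = gh n x + gh n y.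
Proof. by rewrite /gh /= ghost_op // /ev2 rmorphD /= -!/(ev2 _ _ _) ghX ghY. Qed.
Lemma gh_mul n x y : gh n (wmul x y) = gh n x * gh n y.
Proof. by rewrite /gh /= ghost_op // /ev2 rmorphM /= -!/(ev2 _ _ _) ghX ghY. Qed.
Lemma gh_opp n x : gh n (wopp x) = - gh n x.
Proof. by rewrite /gh /= ghost_op // /ev2 rmorphN /= -!/(ev2 _ _ _) ghX. Qed.
Lemma gh_zero n : gh n (wzero pp A) = 0.
Proof.
rewrite /gh /ghost big1 // => i _.
by rewrite /= expr0n gtn_eqF ?mul0rn // expn_gt0 prime_gt0.
Qed.
Lemma gh_one n : gh n (wone pp A) = 1.
Proof.
rewrite /gh /ghost big_ord_recl /= expr1n big1 ?addr0 // => i _.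
by rewrite /= expr0n gtn_eqF ?mul0rn // expn_gt0 prime_gt0.
Qed.

Lemma gh_inj x y : (forall n, gh n x = gh n y) -> x = y.
Proof. by move=> e; apply: wittP => n; apply: (ghost_inj pp tf) => m _; apply: e. Qed.

End Ghosts.

Section Laws.
Variable A : comNzRingType.
Local Notation W := (witt pp A).

Lemma wlift n (x y z : W) : exists (B : comNzRingType) (f : {rmorphism B -> A})
  (x' y' z' : witt pp B), [/\ torsion_free B, wagree n x (wmap f x'),
   wagree n y (wmap f y') & wagree n z (wmap f z')].
Proof.
pose v (j : 'I_3) := nth (wcoord x) [:: wcoord x; wcoord y; wcoord z] j.
exists (gpoly 'I_3 n), (geval v).
exists (Witt pp (gvar n (inord 0))), (Witt pp (gvar n (inord 1))),
  (Witt pp (gvar n (inord 2))); split.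
- by move=> d a b; apply: gpoly_mulrI.
- by move=> i le_in /=; rewrite geval_gvar // /v inordK.
- by move=> i le_in /=; rewrite geval_gvar // /v inordK.
- by move=> i le_in /=; rewrite geval_gvar // /v inordK.
Qed.

Lemma wagree_trans n (x y z : W) : wagree n x y -> wagree n y z -> wagree n x z.
Proof. by move=> e1 e2 i le_in; rewrite e1 // e2. Qed.
Lemma wagree_sym n (x y : W) : wagree n x y -> wagree n y x.
Proof. by move=> e1 i le_in; rewrite e1. Qed.
Lemma wagree_add n (x y x' y' : W) :
  wagree n x x' -> wagree n y y' -> wagree n (wadd x y) (wadd x' y').
Proof.
by move=> ex ey i le_in; apply: witt_op_eq => j le_ji; [apply: ex | apply: ey];
  apply: leq_trans le_ji le_in.
Qed.
Lemma wagree_mul n (x y x' y' : W) :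
  wagree n x x' -> wagree n y y' -> wagree n (wmul x y) (wmul x' y').
Proof.
by move=> ex ey i le_in; apply: witt_op_eq => j le_ji; [apply: ex | apply: ey];
  apply: leq_trans le_ji le_in.
Qed.
Lemma wagree_opp n (x x' : W) : wagree n x x' -> wagree n (wopp x) (wopp x').
Proof.
by move=> ex i le_in; apply: witt_op_eq => j le_ji; apply: ex;
  apply: leq_trans le_ji le_in.
Qed.
Lemma wagree_refl n (x : W) : wagree n x x. Proof. by []. Qed.

Local Opaque wadd wmul wopp.

Lemma wlaw (E1 E2 : forall B : comNzRingType, witt pp B -> witt pp B -> witt pp B -> witt pp B) :
  (forall B : comNzRingType, torsion_free B -> forall x y z : witt pp B, E1 B x y z = E2 B x y z) ->
  (forall (B : comNzRingType) (f : {rmorphism B -> A}) n (x y z : W) x' y' z',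
     wagree n x (wmap f x') -> wagree n y (wmap f y') -> wagree n z (wmap f z') ->
     wagree n (E1 A x y z) (wmap f (E1 B x' y' z')) /\
     wagree n (E2 A x y z) (wmap f (E2 B x' y' z'))) ->
  forall x y z : W, E1 A x y z = E2 A x y z.
Proof.
move=> eE nE x y z; apply: wittP => n.
have [B [f [x' [y' [z' [tf ex ey ez]]]]]] := wlift n x y z.
have [e1 e2] := nE B f n x y z x' y' z' ex ey ez.
by rewrite e1 // e2 // eE.
Qed.

Ltac wnat0 :=
  split; repeat (lazymatch goal with
  | |- wagree _ (wadd _ _) _ => rewrite wmap_add; apply: wagree_add
  | |- wagree _ (wmul _ _) _ => rewrite wmap_mul; apply: wagree_mul
  | |- wagree _ (wopp _) _ => rewrite wmap_opp; apply: wagree_opp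
  | |- wagree _ (wone _ _) _ => rewrite wmap_one; exact: wagree_refl
  | |- wagree _ (wzero _ _) _ => rewrite wmap_zero; exact: wagree_refl
  | _ => assumption end).
Ltac wnat := move=> B f n u1 u2 u3 u1' u2' u3' eu1 eu2 eu3; wnat0.
Ltac wnat2 := move=> B f n u1 u2 u1' u2' eu1 eu2; wnat0.
Ltac wnat1 := move=> B f n u1 u1' eu1; wnat0.
Ltac wgh tf := apply: (gh_inj tf) => n; repeat (match goal with
  | |- context [wcoord (wadd ?a ?b)] => rewrite (gh_add tf _ a b)
  | |- context [wcoord (wmul ?a ?b)] => rewrite (gh_mul tf _ a b)
  | |- context [wcoord (wopp ?a)] => rewrite (gh_opp tf _ a)
  | |- context [wcoord (wone _ _)] => rewrite gh_one
  | |- context [wcoord (wzero _ _)] => rewrite gh_zero end).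
Lemma wlaw2 (E1 E2 : forall B : comNzRingType, witt pp B -> witt pp B -> witt pp B) :
  (forall B : comNzRingType, torsion_free B -> forall x y : witt pp B, E1 B x y = E2 B x y) ->
  (forall (B : comNzRingType) (f : {rmorphism B -> A}) n (x y : W) x' y',
     wagree n x (wmap f x') -> wagree n y (wmap f y') ->
     wagree n (E1 A x y) (wmap f (E1 B x' y')) /\
     wagree n (E2 A x y) (wmap f (E2 B x' y'))) ->
  forall x y : W, E1 A x y = E2 A x y.
Proof.
move=> eE nE x y.
apply: (wlaw (E1 := fun B x y _ => E1 B x y) (E2 := fun B x y _ => E2 B x y)) x.
  by move=> B tf u v _; apply: eE.
by move=> B f n u v _ u' v' _ eu ev _; apply: nE.
Qed.

Lemma wlaw1 (E1 E2 : forall B : comNzRingType, witt pp B -> witt pp B) :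
  (forall B : comNzRingType, torsion_free B -> forall x : witt pp B, E1 B x = E2 B x) ->
  (forall (B : comNzRingType) (f : {rmorphism B -> A}) n (x : W) x',
     wagree n x (wmap f x') ->
     wagree n (E1 A x) (wmap f (E1 B x')) /\ wagree n (E2 A x) (wmap f (E2 B x'))) ->
  forall x : W, E1 A x = E2 A x.
Proof.
move=> eE nE x.
apply: (wlaw2 (E1 := fun B x _ => E1 B x) (E2 := fun B x _ => E2 B x)) x.
  by move=> B tf u _; apply: eE.
by move=> B f n u _ u' _ eu _; apply: nE.
Qed.

Lemma waddA (x y z : W) : wadd x (wadd y z) = wadd (wadd x y) z.
Proof.
apply: (wlaw (E1 := fun B (x y z : witt pp B) => wadd x (wadd y z))
             (E2 := fun B (x y z : witt pp B) => wadd (wadd x y) z)); last wnat.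
by move=> B tf {}x {}y {}z; wgh tf; rewrite addrA.
Qed.
Lemma waddC (x y : W) : wadd x y = wadd y x.
Proof.
apply: (wlaw2 (E1 := fun B (x y : witt pp B) => wadd x y)
             (E2 := fun B (x y : witt pp B) => wadd y x)); last wnat2.
by move=> B tf {}x {}y; wgh tf; rewrite addrC.
Qed.
Lemma wadd0 (x : W) : wadd (wzero pp A) x = x.
Proof.
apply: (wlaw1 (E1 := fun B (x : witt pp B) => wadd (wzero pp B) x)
             (E2 := fun B (x : witt pp B) => x)); last wnat1.
by move=> B tf {}x; wgh tf; rewrite add0r.
Qed.
Lemma waddN (x : W) : wadd (wopp x) x = wzero pp A.
Proof.
apply: (wlaw1 (E1 := fun B (x : witt pp B) => wadd (wopp x) x)
             (E2 := fun B (x : witt pp B) => wzero pp B)); last wnat1.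
by move=> B tf {}x; wgh tf; rewrite addNr.
Qed.
Lemma wmulA (x y z : W) : wmul x (wmul y z) = wmul (wmul x y) z.
Proof.
apply: (wlaw (E1 := fun B (x y z : witt pp B) => wmul x (wmul y z))
             (E2 := fun B (x y z : witt pp B) => wmul (wmul x y) z)); last wnat.
by move=> B tf {}x {}y {}z; wgh tf; rewrite mulrA.
Qed.
Lemma wmulC (x y : W) : wmul x y = wmul y x.
Proof.
apply: (wlaw2 (E1 := fun B (x y : witt pp B) => wmul x y)
             (E2 := fun B (x y : witt pp B) => wmul y x)); last wnat2.
by move=> B tf {}x {}y; wgh tf; rewrite mulrC.
Qed.
Lemma wmul1 (x : W) : wmul (wone pp A) x = x.
Proof.
apply: (wlaw1 (E1 := fun B (x : witt pp B) => wmul (wone pp B) x)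
             (E2 := fun B (x : witt pp B) => x)); last wnat1.
by move=> B tf {}x; wgh tf; rewrite mul1r.
Qed.
Lemma wmulDl (x y z : W) : wmul (wadd x y) z = wadd (wmul x z) (wmul y z).
Proof.
apply: (wlaw (E1 := fun B (x y z : witt pp B) => wmul (wadd x y) z)
             (E2 := fun B (x y z : witt pp B) => wadd (wmul x z) (wmul y z))); last wnat.
move=> B tf {}x {}y {}z; apply: (gh_inj tf) => n.
rewrite [LHS](gh_mul tf n (wadd x y) z) [X in X * _](gh_add tf n x y).
rewrite [RHS](gh_add tf n (wmul x z) (wmul y z)) [X in _ = X + _](gh_mul tf n x z).
by rewrite [X in _ = _ + X](gh_mul tf n y z) mulrDl.
Qed.
Local Transparent wadd wmul wopp.

Lemma wone_neq0 : wone pp A != wzero pp A.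
Proof.
apply/eqP => /(congr1 (fun x => wcoord x 0%N)) /= /eqP.
by rewrite oner_eq0.
Qed.

HB.instance Definition _ := GRing.isZmodule.Build W waddA waddC wadd0 waddN.
HB.instance Definition _ :=
  GRing.Zmodule_isComNzRing.Build W wmulA wmulC wmul1 wmulDl wone_neq0.

End Laws.
End WittLaws.

Section LocalizedIntegers.
Variable p : nat.

Definition plocal : {pred rat} := [pred x : rat | coprime p `|denq x|%N].

Lemma plocalP (x : rat) (m : int) (d : nat) :
  coprime p d -> x * d%:R = m%:~R -> x \in plocal.
Proof.
move=> cpd e; rewrite inE; apply: coprime_dvdr cpd.
have e' : numq x * d%:Z = m * denq x.
  apply: (@intr_inj rat); rewrite !rmorphM /= -e numqE.
  by rewrite mulrAC -pmulrn.
have : (`|denq x| %| `|numq x| * d)%N.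
  by rewrite -[d]/(`|d%:Z|)%N -abszM e' abszM dvdn_mull.
by rewrite Gauss_dvdr // coprime_sym coprime_num_den.
Qed.

Lemma plocal_den (x : rat) : x * `|denq x|%:R = (numq x)%:~R.
Proof.
by rewrite pmulrn absz_denq numqE.
Qed.

Lemma plocal_subring : subring_closed plocal.
Proof.
split=> [|x y|x y]; rewrite ?inE ?coprimen1 //.
  move=> cx cy; have cxy : coprime p (`|denq x| * `|denq y|) by rewrite coprimeMr cx.
  apply: (plocalP (m := numq x * `|denq y|%:Z - numq y * `|denq x|%:Z) cxy).
  rewrite natrM mulrBl mulrA plocal_den [_ * _%:R as X in y * X]mulrC mulrA plocal_den.
  by rewrite rmorphB !rmorphM.
move=> cx cy; have cxy : coprime p (`|denq x| * `|denq y|) by rewrite coprimeMr cx.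
apply: (plocalP (m := numq x * numq y) cxy).
by rewrite natrM mulrACA !plocal_den rmorphM.
Qed.

HB.instance Definition _ := GRing.isSubringClosed.Build rat plocal plocal_subring.

(* Z_(p) *)
Record zlocal := Zlocal { zlocal_val :> rat; _ : zlocal_val \in plocal }.
HB.instance Definition _ := [isSub for zlocal_val].
HB.instance Definition _ := [Choice of zlocal by <:].
HB.instance Definition _ := [SubChoice_isSubComNzRing of zlocal by <:].

End LocalizedIntegers.

(* Formal power series in n variables over A *)
Record series (n : nat) (A : Type) := Series { scoef : multinom n -> A }.

HB.instance Definition _ n A := gen_eqMixin (series n A).
HB.instance Definition _ n A := gen_choiceMixin (series n A).

Section SeriesRing.
Variables (n : nat) (A : comNzRingType).
Local Notation S := (series n A).
Implicit Types f g h : S.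

Lemma seriesP f g : scoef f =1 scoef g -> f = g.
Proof. by case: f g => [f] [g] /= /funext->. Qed.

Definition series_zero : S := Series (fun=> 0).
Definition series_const (c : A) : S := Series (fun m => c *+ (m == 0%MM)).
Definition series_add f g : S := Series (fun m => scoef f m + scoef g m).
Definition series_opp f : S := Series (fun m => - scoef f m).
Definition series_mul f g : S := Series (fun m =>
  \sum_(k : 'X_{1..n < (mdeg m).+1, (mdeg m).+1} | m == (k.1 + k.2)%MM)
     scoef f k.1 * scoef g k.2).

Definition truncate d f : mpoly n A := \sum_(m : 'X_{1..n < d}) scoef f m *: 'X_[m].

Lemma truncateE d f m : (mdeg m < d)%N -> (truncate d f)@_m = scoef f m.
Proof. exact: mcoeff_mpoly. Qed.

Lemma series_mulE f g m (F G : mpoly n A) :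
  (forall k, (mdeg k <= mdeg m)%N -> F@_k = scoef f k) ->
  (forall k, (mdeg k <= mdeg m)%N -> G@_k = scoef g k) ->
  scoef (series_mul f g) m = (F * G)@_m.
Proof.
move=> eF eG; rewrite mcoeffM; apply: eq_bigr => -[k l] _ /=.
by rewrite eF ?eG // -ltnS bmdeg.
Qed.

Lemma series_mul_trunc d f g m : (mdeg m < d)%N ->
  scoef (series_mul f g) m = (truncate d f * truncate d g)@_m.
Proof.
by move=> lt_md; apply: series_mulE => k le_km; rewrite truncateE //;
  apply: leq_ltn_trans le_km lt_md.
Qed.

Lemma series_addA : associative series_add.
Proof. by move=> f g h; apply: seriesP => m /=; rewrite addrA. Qed.
Lemma series_addC : commutative series_add.
Proof. by move=> f g; apply: seriesP => m /=; rewrite addrC. Qed.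
Lemma series_add0 : left_id series_zero series_add.
Proof. by move=> f; apply: seriesP => m /=; rewrite add0r. Qed.
Lemma series_addN : left_inverse series_zero series_opp series_add.
Proof. by move=> f; apply: seriesP => m /=; rewrite addNr. Qed.
Lemma series_mulC : commutative series_mul.
Proof.
move=> f g; apply: seriesP => m.
by rewrite !(series_mul_trunc _ _ (ltnSn _)) mulrC.
Qed.
Lemma series_mulA : associative series_mul.
Proof.
move=> f g h; apply: seriesP => m; pose T := truncate (mdeg m).+1.
rewrite (@series_mulE _ _ _ (T f) (T g * T h)) => [|k lk|k lk].
- rewrite (@series_mulE _ _ _ (T f * T g) (T h)) ?mulrA // => k lk.
    by rewrite (@series_mul_trunc (mdeg m).+1).
  by rewrite truncateE.
- by rewrite truncateE.
by rewrite (@series_mul_trunc (mdeg m).+1).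
Qed.
Lemma series_mul1 : left_id (series_const 1) series_mul.
Proof.
move=> f; apply: seriesP => m; pose T := truncate (mdeg m).+1.
rewrite (@series_mulE _ _ _ 1 (T f)) ?mul1r => [|k lk|k lk].
- by rewrite truncateE.
- by rewrite mcoeff1.
- by rewrite truncateE.
Qed.
Lemma series_mulDl : left_distributive series_mul series_add.
Proof.
move=> f g h; apply: seriesP => m; rewrite /= -big_split.
by apply: eq_bigr => k _; rewrite mulrDl.
Qed.
Lemma series_one_neq0 : series_const 1 != series_zero.
Proof.
apply/eqP => /(congr1 (fun f => scoef f 0%MM)) /= /eqP.
by rewrite eqxx oner_eq0.
Qed.

HB.instance Definition _ :=
  GRing.isZmodule.Build S series_addA series_addC series_add0 series_addN.
HB.instance Definition _ := GRing.Zmodule_isComNzRing.Build S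
  series_mulA series_mulC series_mul1 series_mulDl series_one_neq0.

Definition series_var (i : 'I_n) : S := Series (fun m => (m == U_(i)%MM)%:R).

End SeriesRing.

Notation "c %:S" := (series_const _ c) (at level 2, left associativity, format "c %:S")
  : ring_scope.

Definition series_map n (A B : Type) (phi : A -> B) (f : series n A) : series n B :=
  Series (phi \o scoef f).

(* f(g_1, ..., g_n), for series g_i without constant term: a monomial of degree
   larger than that of m does not contribute to the coefficient of m *)
Definition series_subst n k (A : comNzRingType) (f : series n A)
    (g : 'I_n -> series k A) : series k A :=
  Series (fun m => \sum_(e : 'X_{1..n < (mdeg m).+1})
    scoef f e * scoef (\prod_(i < n) g i ^+ e i) m).

Definition pair2 (T : Type) (a b : T) : 'I_2 -> T := fun i => if i == ord0 then a else b.

Definition svar n (A : comNzRingType) (i : nat) : series n.+1 A :=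
  series_var A (inord i).

Definition formal_group_law (A : comNzRingType) (G : series 2 A) : Prop :=
  let t := svar 0 A 0 in
  let x := svar 2 A 0 in let y := svar 2 A 1 in let z := svar 2 A 2 in
  let G3 a b := series_subst G (pair2 a b) in
  [/\ series_subst G (pair2 t 0) = t,
      series_subst G (pair2 0 t) = t,
      series_subst G (pair2 (svar 1 A 1) (svar 1 A 0)) = G &
      G3 (G3 x y) z = G3 x (G3 y z)].

Definition is_logarithm (A : comNzRingType) (L : series 1 A) (G : series 2 A) : Prop :=
  [/\ scoef L 0%MM = 0,
      scoef L U_(ord0)%MM = 1 &
      series_subst L (fun=> G) =
        series_subst L (fun=> svar 1 A 0) + series_subst L (fun=> svar 1 A 1)].

(* \sum_i l_i x^(p^i) *)
Definition ptypical_series (A : comNzRingType) (p : nat) (l : nat -> A) : series 1 A :=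
  Series (fun m => \sum_(i < (m ord0).+1 | (m ord0 == p ^ i)%N) l i).

(* K[v_1, v_2, ...]; the variable with index i : nat is v_(i+1), and v_0 = p *)
Notation vpoly K := (malg (cmonom nat) K).

Section Araki.
Variable p : nat.

Definition vconst (K : comNzRingType) (c : K) : vpoly K := c%:A.

Definition araki (K : comNzRingType) (i : nat) : vpoly K :=
  if i is j.+1 then mkmalgU (ucm j) 1 else p%:R.

Definition vrat : vpoly (zlocal p) -> vpoly rat :=
  monalg.mmap (fun c : zlocal p => vconst (zlocal_val c)) (fun m => mkmalgU m 1).

Definition araki_log_coefs (l : nat -> vpoly rat) : Prop :=
  l 0%N = 1 /\
  forall n, p%:R * l n = \sum_(i < n.+1) l i * araki rat (n - i) ^+ (p ^ i).

Definition universal_ptypical (G : series 2 (vpoly (zlocal p))) : Prop :=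
  formal_group_law G /\
  exists2 l, araki_log_coefs l & is_logarithm (ptypical_series p l) (series_map vrat G).

End Araki.

(* u_i for 0 < i < h, in A[[u_1, ..., u_(h-1)]] *)
Definition defparam (h : nat) (A : comNzRingType) (i : nat) : series h.-1 A :=
  \sum_(j < h.-1 | j.+1 == i) series_var A j.

Section Ideals.
Variable A : comNzRingType.
Implicit Types (S I : A -> Prop) (z : A).

Definition ideal_span S z : Prop :=
  exists n (c s : 'I_n -> A), (forall i, S (s i)) /\ z = \sum_i c i * s i.

Definition ideal_exp I (N : nat) : A -> Prop :=
  ideal_span (fun z => exists2 t : 'I_N -> A, forall i, I (t i) & z = \prod_i t i).

End Ideals.

Section RationalPolynomials.
Variables p h : nat.
Let q := (p ^ h.-1)%N.
Let x := svar 1 rat 0.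
Let y := svar 1 rat 1.

Definition Cpoly (n : nat) : series 2 rat :=
  (p%:R^-1)%:S * ((x + y) ^+ (p ^ n) - x ^+ (p ^ n) - y ^+ (p ^ n)).

Definition Ppoly (m : nat) : series 2 rat :=
  ((p%:R - p%:R ^+ q) ^- m.+1)%:S *
  \sum_(j < m.+1)
    ((-1) ^+ j.+1 / j.+1%:R * 'C(q * j.+1, j)%:R * 'C(j * (q - 1) + q, m - j)%:R)%:S *
    (x + y) ^+ (q * j.+1 - m) * (x ^+ q + y ^+ q) ^+ (m - j).

End RationalPolynomials.

(* Main.v *)
Require Import Defs.
From HB Require Import structures.
From mathcomp Require Import all_boot all_order all_algebra.
From mathcomp Require Import finmap monalg mpoly ring zify.

(** Modulo [u_1, ..., u_(h-2)] the ring [V] acts through [v_(h-1) = u], [v_h = 1] and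
    [v_i = 0] otherwise, so it suffices to compute over [Z_(p)[u]], inside [Q[u]].
    With [q = p^(h-1)] and [N = p^h], the Araki recursion gives there the logarithm
    [z + a z^q + b z^N] up to degree [N], where [a = u / (p - p^q)] and
    [b = 1 / (p - p^N)]; the hypothesis [h > 2] excludes a term [l_1 u^p] in [b].
    Up to degree [N] its inverse is
      [E(s) = s + \sum_(j < p) c_j a^(j+1) s^(q(j+1)-j) - b s^N],
    with the Lagrange coefficients [c_j = (-1)^(j+1) / (j+1) * binomial(q(j+1), j)],
    and [E] maps the truncated [log x + log y] to the stated formula. Since the
    universal law has coefficients in [Z_(p)[v]], comparing powers of [u] shows that
    [A], [B] and the [P_m] are p-integral. *)

Set Implicit Arguments.
Unset Strict Implicit.
Unset Printing Implicit Defensive.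

Import GRing.Theory Num.Theory.
Local Open Scope ring_scope.

(** * Coefficients of sums and products of power series *)

Section SeriesCoefficients.
Variables (n : nat) (A : comNzRingType).
Implicit Types (c : A) (f g : series n A) (m : 'X_{1..n}).

Lemma scoefD f g m : scoef (f + g) m = scoef f m + scoef g m.
Proof. by []. Qed.

Lemma scoefB f g m : scoef (f - g) m = scoef f m - scoef g m.
Proof. by []. Qed.

Lemma scoef_sum (I : Type) (r : seq I) (P : pred I) (F : I -> series n A) m :
  scoef (\sum_(i <- r | P i) F i) m = \sum_(i <- r | P i) scoef (F i) m.
Proof. by apply: (big_morph (fun f => scoef f m)). Qed.

Lemma scoefM f g m : scoef (f * g) m =
  \sum_(k : 'X_{1..n < (mdeg m).+1, (mdeg m).+1} | m == (k.1 + k.2)%MM)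
     scoef f k.1 * scoef g k.2.
Proof. by []. Qed.

Lemma scoefCM c f m : scoef (c%:S * f) m = c * scoef f m.
Proof.
rewrite (_ : scoef (c%:S * f) m = (c%:MP * truncate (mdeg m).+1 f)@_m); last first.
  apply: series_mulE => k lk; last by rewrite truncateE.
  by rewrite mcoeffC /= mulr_natr.
by rewrite mcoeffCM truncateE.
Qed.

Lemma scoef_varM i f m : scoef (series_var A i * f) m =
  if m i == 0%N then 0 else scoef f (m - U_(i))%MM.
Proof.
case: ifP => mi0.
  rewrite scoefM big1 // => k /eqP ek /=; case: eqP => [k1|]; last by rewrite mul0r.
  by have /= := congr1 (fun e : 'X_{1..n} => e i) ek; rewrite mnmDE k1 mnm1E eqxx (eqP mi0).
have Um : (U_(i) <= m)%MM by rewrite lep1mP mi0.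
rewrite (_ : scoef _ m = ('X_i * truncate (mdeg m).+1 f)@_m); last first.
  apply: series_mulE => k lk; last by rewrite truncateE.
  by rewrite mcoeffX eq_sym.
rewrite -commr_mpolyX -{1}(submK Um) addmC mcoeffMX truncateE //.
by rewrite ltnS mdegB.
Qed.

Lemma series_constD : {morph @series_const n A : c d / c + d}.
Proof. by move=> c d; apply: seriesP => m /=; rewrite mulrnDl. Qed.

Lemma series_constM : {morph @series_const n A : c d / c * d}.
Proof. by move=> c d; apply: seriesP => m; rewrite scoefCM /= mulrnAr. Qed.

Lemma series_constB : {morph @series_const n A : c d / c - d}.
Proof. by move=> c d; apply: seriesP => m /=; rewrite mulrnBl. Qed.

HB.instance Definition _ := GRing.isZmodMorphism.Build A (series n A)
  (@series_const n A) series_constB.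
HB.instance Definition _ := GRing.isMonoidMorphism.Build A (series n A)
  (@series_const n A) (erefl, series_constM).

End SeriesCoefficients.

(** * Order of vanishing and total degree *)

Section Order.
Variables (n : nat) (A : comNzRingType).
Implicit Types (f g : series n A) (d e : nat).

(** Congruence modulo the [d]th power of the ideal of the variables is handled as [order_ge d] of a
    difference. *)
Definition order_ge d f := forall m, (mdeg m < d)%N -> scoef f m = 0.
Definition degree_le d f := forall m, (d < mdeg m)%N -> scoef f m = 0.

Lemma order_geW d e f : (d <= e)%N -> order_ge e f -> order_ge d f.
Proof. by move=> de fe m md; apply: fe; apply: leq_trans de. Qed.

Lemma order_geD d f g : order_ge d f -> order_ge d g -> order_ge d (f + g).
Proof. by move=> fd gd m md; rewrite scoefD fd // gd // addr0. Qed.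

Lemma order_geN d f : order_ge d f -> order_ge d (- f).
Proof. by move=> fd m md; rewrite /= fd // oppr0. Qed.

Lemma order_geB d f g : order_ge d f -> order_ge d g -> order_ge d (f - g).
Proof. by move=> fd gd; apply/order_geD/order_geN. Qed.

Lemma order_ge_sum d (I : Type) (r : seq I) (P : pred I) (F : I -> series n A) :
  (forall i, P i -> order_ge d (F i)) -> order_ge d (\sum_(i <- r | P i) F i).
Proof. by move=> Fd; elim/big_ind: _ => //; apply: order_geD. Qed.

Lemma order_geM d e f g : order_ge d f -> order_ge e g -> order_ge (d + e) (f * g).
Proof.
move=> fd ge m md; rewrite scoefM big1 // => -[k1 k2] /eqP/(congr1 mdeg).
rewrite /= mdegD => ek; have [lt_k1|le_k1] := ltnP (mdeg k1) d.
  by rewrite fd // mul0r.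
by rewrite ge ?mulr0 //; lia.
Qed.

Lemma order_geMl d f g : order_ge d g -> order_ge d (f * g).
Proof. by move=> gd; apply: (@order_geM 0). Qed.

Lemma order_geX d f k : order_ge d f -> order_ge (d * k) (f ^+ k).
Proof.
move=> fd; elim: k => [|k IH]; first by rewrite muln0.
by rewrite exprS mulnS; apply: order_geM.
Qed.

Lemma order_geXn f k : order_ge 1 f -> order_ge k (f ^+ k).
Proof. by move/(@order_geX _ _ k); rewrite mul1n. Qed.

Lemma order_ge_var i : order_ge 1 (series_var A i : series n A).
Proof. by case=> m /=; case: eqP => // ->; rewrite mdeg1. Qed.

Lemma degree_leW d e f : (e <= d)%N -> degree_le e f -> degree_le d f.
Proof. by move=> de fe m md; apply: fe; apply: leq_ltn_trans md. Qed.

Lemma degree_leD d f g : degree_le d f -> degree_le d g -> degree_le d (f + g).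
Proof. by move=> fd gd m md; rewrite scoefD fd // gd // addr0. Qed.

Lemma degree_leB d f g : degree_le d f -> degree_le d g -> degree_le d (f - g).
Proof. by move=> fd gd m md; rewrite scoefB fd // gd // subr0. Qed.

Lemma degree_le_sum d (I : Type) (r : seq I) (P : pred I) (F : I -> series n A) :
  (forall i, P i -> degree_le d (F i)) -> degree_le d (\sum_(i <- r | P i) F i).
Proof. by move=> Fd; elim/big_ind: _ => //; apply: degree_leD. Qed.

Lemma degree_leM d e f g : degree_le d f -> degree_le e g -> degree_le (d + e) (f * g).
Proof.
move=> fd ge m md; rewrite scoefM big1 // => -[k1 k2] /eqP/(congr1 mdeg).
rewrite /= mdegD => ek; have [lt_k1|le_k1] := ltnP d (mdeg k1).
  by rewrite fd // mul0r.
by rewrite ge ?mulr0 //; lia.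
Qed.

Lemma degree_leC c : degree_le 0 (c%:S : series n A).
Proof. by move=> m; rewrite lt0n mdeg_eq0 /= => /negPf->. Qed.

Lemma degree_leCM d c f : degree_le d f -> degree_le d (c%:S * f).
Proof. by move=> fd m md; rewrite scoefCM fd ?mulr0. Qed.

Lemma degree_leX d f k : degree_le d f -> degree_le (d * k) (f ^+ k).
Proof.
move=> fd; elim: k => [|k IH]; first by rewrite muln0; apply: degree_leC.
by rewrite exprS mulnS; apply: degree_leM.
Qed.

Lemma degree_le_var i : degree_le 1 (series_var A i : series n A).
Proof. by move=> m /=; case: eqP => // ->; rewrite mdeg1. Qed.

(** The cofactor of [f - g] in [f ^+ k - g ^+ k] is a sum of products of [k - 1] series of positive
    order. *)
Lemma order_ge_subX d f g k : order_ge 1 f -> order_ge 1 g ->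
  order_ge d.+1 (f - g) -> order_ge (d + k) (f ^+ k - g ^+ k).
Proof.
move=> f1 g1 fgd; case: k => [|k]; first by rewrite subrr.
rewrite subrXX addnS -addSn; apply: order_geM fgd _.
apply: order_ge_sum => i _; apply: (@order_geW _ (k - i + i)%N); last first.
  by apply: order_geM; apply: order_geXn.
by rewrite subnK // -ltnS.
Qed.

End Order.

(** * Change of coefficient ring *)

Section SeriesMap.
Variables (n : nat) (A B : comNzRingType) (phi : {rmorphism A -> B}).
Implicit Types (f g : series n A).

Lemma series_mapB : {morph @series_map n A B phi : f g / f - g}.
Proof. by move=> f g; apply: seriesP => m /=; rewrite rmorphB. Qed.

Lemma series_mapM : {morph @series_map n A B phi : f g / f * g}.
Proof.
move=> f g; apply: seriesP => m; rewrite /= rmorph_sum.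
by apply: eq_bigr => k _; rewrite rmorphM.
Qed.

Lemma series_mapC c : series_map phi (c%:S : series n A) = (phi c)%:S.
Proof. by apply: seriesP => m /=; rewrite rmorphMn. Qed.

Lemma series_map_var i : series_map phi (series_var A i : series n A) = series_var B i.
Proof. by apply: seriesP => m /=; rewrite rmorph_nat. Qed.

Lemma series_map1 : series_map phi (1 : series n A) = 1.
Proof. by rewrite series_mapC rmorph1. Qed.

HB.instance Definition _ := GRing.isZmodMorphism.Build (series n A) (series n B)
  (series_map phi : series n A -> series n B) series_mapB.
HB.instance Definition _ := GRing.isMonoidMorphism.Build (series n A) (series n B)
  (series_map phi : series n A -> series n B) (series_map1, series_mapM).

Lemma series_mapD f g : series_map phi (f + g) = series_map phi f + series_map phi g.
Proof. exact: rmorphD. Qed.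

Lemma series_mapX k f : series_map phi (f ^+ k) = series_map phi f ^+ k.
Proof. exact: rmorphXn. Qed.

Lemma series_map_sum (I : Type) (r : seq I) (P : pred I) (F : I -> series n A) :
  series_map phi (\sum_(i <- r | P i) F i) = \sum_(i <- r | P i) series_map phi (F i).
Proof. exact: rmorph_sum. Qed.

Lemma order_ge_map d f : order_ge d f -> order_ge d (series_map phi f).
Proof. by move=> fd m md; rewrite /= fd // rmorph0. Qed.

End SeriesMap.

(** * Truncation of a p-typical logarithm *)

Section LogTruncation.
Variables (p h : nat) (A : comNzRingType) (l : nat -> A).
Hypothesis p_gt1 : (1 < p)%N.

(** Since [z ^+ (p ^ i)] has order at least [p ^ i], the terms with [i > h] only contribute above
    degree [p ^ h]. *)
Lemma log_trunc n (z : series n A) : order_ge 1 z ->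
  order_ge (p ^ h).+1 (series_subst (ptypical_series p l) (fun=> z)
    - \sum_(i < h.+1) (l i)%:S * z ^+ (p ^ i)).
Proof.
move=> z1 m; rewrite ltnS => mh; rewrite scoefB scoef_sum.
rewrite (eq_bigr _ (fun i _ => scoefCM _ _ _)).
apply/eqP; rewrite subr_eq0; apply/eqP => /=.
pose T (e : 'X_{1..1 < (mdeg m).+1}) (i : 'I_h.+1) := l i * scoef (z ^+ (p ^ i)) m.
transitivity (\sum_(e : 'X_{1..1 < (mdeg m).+1})
                \sum_(i < h.+1 | e ord0 == (p ^ i)%N) T e i).
  apply: eq_bigr => e _.
  have lee : (e ord0 <= mdeg m)%N.
    by have := bmdeg e; rewrite mdegE big_ord1 ltnS.
  rewrite big_distrl /= big_ord1.
  (* The series bounds [i] by the exponent [e ord0], the truncation by [h]; both bounds are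
     automatic once [e ord0 = p ^ i]. *)
  pose N := maxn (e ord0).+1 h.+1.
  rewrite (big_ord_widen_cond N (fun i => e ord0 == (p ^ i)%N)
     (fun i => l i * scoef (z ^+ e ord0) m)) ?leq_maxl //.
  rewrite (big_ord_widen_cond N (fun i => e ord0 == (p ^ i)%N)
     (fun i => l i * scoef (z ^+ (p ^ i)) m)) ?leq_maxr //.
  apply: eq_big => [i|i /andP[/eqP-> //]].
  case: eqP => //= ei; rewrite !ltnS -(leq_exp2l i h p_gt1) -ei (leq_trans lee mh).
  by rewrite ei ltnW // ltn_expl.
rewrite (exchange_big_dep predT) //=; apply: eq_bigr => i _.
rewrite sumr_const; have [le_im|lt_mi] := leqP (p ^ i) (mdeg m); last first.
  by rewrite (order_geXn z1) // mulr0 mul0rn.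
have dU : (mdeg (U_(ord0) *+ (p ^ i) : 'X_{1..1}) < (mdeg m).+1)%N.
  by rewrite mdegMn mdeg1 mul1n.
rewrite (eq_card (_ : _ =i pred1 (BMultinom dU))) ?card1 // => e.
rewrite !inE bmeqP /=; apply/eqP/eqP => [ei|->]; last by rewrite mulmnE mnm1E mul1n.
by apply/mnmP=> j; rewrite (ord1 j) mulmnE mnm1E mul1n.
Qed.

End LogTruncation.

(** * Binomial identities behind Lagrange inversion *)

Lemma mul_bin_bin N m j : (j <= m)%N ->
  ('C(N, j) * 'C(N - j, m - j) = 'C(N, m) * 'C(m, j))%N.
Proof.
move=> le_jm; have [lt_Nm|le_mN] := ltnP N m.
  rewrite (bin_small lt_Nm) mul0n; have [lt_Nj|le_jN] := ltnP N j.
    by rewrite (bin_small lt_Nj) mul0n.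
  by rewrite (@bin_small (N - j)) ?muln0 //; lia.
have e1 := bin_fact (leq_trans le_jm le_mN).
have e2 := bin_fact (leq_sub2r j le_mN).
have e3 := bin_fact le_mN; have e4 := bin_fact le_jm.
have Nm : (N - j - (m - j) = N - m)%N by lia.
apply/eqP; rewrite -(eqn_pmul2r (fact_gt0 j)) -(eqn_pmul2r (fact_gt0 (m - j))).
rewrite -(eqn_pmul2r (fact_gt0 (N - m))); apply/eqP.
rewrite Nm in e2; transitivity N`!%N; first by rewrite -e1 -e2; ring.
by rewrite -e3 -e4; ring.
Qed.

Lemma coef_exp1X (A : nzRingType) k m : ((1 + 'X : {poly A}) ^+ k)`_m = 'C(k, m)%:R.
Proof.
rewrite exprDn_comm; last exact/commr_sym/commr1.
transitivity ((\poly_(i < k.+1) ('C(k, i)%:R : A))`_m).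
  rewrite poly_def !coef_sum; apply: eq_bigr => i _.
  by rewrite expr1n mul1r scaler_nat.
by rewrite coef_poly; case: ltnP => // /bin_small->.
Qed.

(* The [n]th finite difference of [k |-> 'C(q * k, m)], a polynomial of degree [m]
   in [k], read off as a coefficient of [(1 - (1 + 'X) ^+ q) ^+ n] *)
Lemma sum_sign_bin_bin (A : comNzRingType) q n m : (m < n)%N ->
  \sum_(k < n.+1) (-1) ^+ k * 'C(n, k)%:R * 'C(q * k, m)%:R = 0 :> A.
Proof.
move=> lt_mn; pose y : {poly A} := (1 + 'X) ^+ q.
have : ((1 - y) ^+ n)`_m = 0.
  rewrite -[in 1 - y](expr1n _ q) subrXX opprD addrA subrr add0r.
  by rewrite exprMn exprNn [(-1) ^+ n * _]mulrC -mulrA coefXnM lt_mn.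
rewrite exprBn coef_sum; apply: etrans; apply: eq_bigr => k _.
rewrite expr1n mulr1 -exprM coefMn -(rmorphN1 polyC) -rmorphXn coefCM coef_exp1X.
by rewrite -[RHS]mulr_natr mulrAC.
Qed.

(** Lagrange inversion: the coefficient of [a^(j+1) s^(q(j+1)-j)] in the compositional inverse of
    [z + a z^q]. *)
Definition inv_coef (q j : nat) : rat := (-1) ^+ j.+1 / j.+1%:R * 'C(q * j.+1, j)%:R.

(** This is the coefficient of [a^(m+1) z^(q(m+1)-m)] when [s = z + a z^q] is put into the nonlinear
    part of the inverse. Multiplied by [m + 1], the sum is the finite difference of
    [sum_sign_bin_bin] of order [m + 1] without its term [k = 0]. *)
Lemma sum_inv_coef q m :
  \sum_(j < m.+1) inv_coef q j * 'C(q * j.+1 - j, m - j)%:R = - (m == 0%N)%:R.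
Proof.
have := sum_sign_bin_bin rat q (ltnSn m).
rewrite big_ord_recl /= expr0 bin0 muln0 bin0n !mul1r => /eqP.
rewrite addrC addr_eq0 => /eqP e.
apply: (@mulfI _ m.+1%:R); first by rewrite pnatr_eq0.
rewrite mulr_sumr; transitivity (- (m == 0%N)%:R : rat); last first.
  by case: m {e} => [|m]; rewrite ?mul1r // oppr0 mulr0.
rewrite -e; apply: eq_bigr => j _.
have le_jm : (j <= m)%N by rewrite -ltnS.
rewrite /inv_coef /bump /= add1n.
have /(congr1 (fun n => n%:R : rat)) := mul_bin_bin (q * j.+1) le_jm.
have /(congr1 (fun n => n%:R : rat)) := mul_bin_diag m.+1 j.
rewrite !natrM /= => e1 e2.
have : (j.+1%:R : rat) != 0 by rewrite pnatr_eq0.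
move: (j.+1%:R : rat) e1 => d e1 j0.
rewrite -[_ * _ * 'C(_ - _, _)%:R]mulrA e2; apply: (mulfI j0).
transitivity ((-1) ^+ j.+1 * (m.+1%:R * 'C(m, j)%:R) * 'C(q * j.+1, m)%:R : rat).
  by field.
by rewrite e1; ring.
Qed.

(** * Substitution into the truncated inverse *)

Lemma expand_diff (V : zmodType) (s S S' b b' : V) :
  s + S - b - (s - b' + S') = S - S' - (b - b').
Proof.
rewrite -(addrA s S) -(addrA s (- b')) [- b' + S']addrC opprD addrACA subrr add0r !opprB.
by rewrite [b' - S']addrC addrACA [- b + b']addrC.
Qed.

Lemma collect_powers (S : comNzRingType) (x y c v w : S) N :
  x * y * (c *+ N * v * w) = c * y * (v * (x * w) *+ N).
Proof. by rewrite -[c *+ N]mulr_natr -[X in _ = _ * X]mulr_natr; ring. Qed.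

Section Inversion.
Variables (n : nat) (K : comNzRingType) (p q : nat).
Variables (a b : series n K) (c : nat -> series n K).
Hypotheses (p_gt1 : (1 < p)%N) (lt_pq : (p < q)%N).
Implicit Types s w : series n K.

(** Terms with [j >= p] are left out: for [p < q] their exponent [q (j + 1) - j] exceeds [p q]. *)
Definition inv_series s :=
  s + \sum_(j < p) c j * a ^+ j.+1 * s ^+ (q * j.+1 - j) - b * s ^+ (p * q).

(** The binomial theorem with [m - j] as exponent of [a * w2], so that with the prefactor
    [a ^+ j.+1] the power of [a] is [m + 1]. Terms with [m >= p] have order at least
    [q (m + 1) - m], which exceeds [p q]. *)
Lemma binom_trunc w1 w2 j : order_ge 1 w1 -> order_ge q w2 -> (j < p)%N ->
  order_ge (p * q).+1 ((w1 + a * w2) ^+ (q * j.+1 - j) -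
    \sum_(m < p | (j <= m)%N)
      w1 ^+ (q * j.+1 - m) * (a * w2) ^+ (m - j) *+ 'C(q * j.+1 - j, m - j)).
Proof.
move=> o1 o2 lt_jp; set N := (q * j.+1 - j)%N.
have eN : (N = q * j + (q - j))%N by rewrite /N mulnS; nia.
pose T i := w1 ^+ (N - i) * (a * w2) ^+ i *+ 'C(N, i).
rewrite exprDn -(big_mkord predT T) (@big_cat_nat _ _ _ (p - j)%N) //=; last by nia.
pose U m := w1 ^+ (q * j.+1 - m) * (a * w2) ^+ (m - j) *+ 'C(N, m - j).
have -> : \sum_(m < p | (j <= m)%N) U m = \sum_(0 <= i < p - j) T i.
  rewrite -(big_geq_mkord j p predT U); have := big_addn 0 p j predT U.
  rewrite add0n => ->; apply: eq_bigr => i _.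
  by rewrite /U /T addnK /N -subnDA addnC.
rewrite addrAC subrr add0r big_nat_cond; apply: order_ge_sum => i.
rewrite andbT => /andP[le_i lt_iN]; rewrite /T -mulr_natr mulrC; apply: order_geMl.
apply: (@order_geW _ _ _ (N - i + q * i)%N); last first.
  by apply: order_geM; [apply: order_geXn|apply/order_geX/order_geMl].
by nia.
Qed.

(** Having order [p q], [b * w3] survives only in the linear term of the inverse, and only [w1]
    survives in [b * s ^+ (p * q)]. The rest is [binom_trunc], collected by powers of [a]. *)
Lemma inv_series_expand w1 w2 w3 :
  order_ge 1 w1 -> order_ge q w2 -> order_ge (p * q) w3 ->
  order_ge (p * q).+1 (inv_series (w1 + a * w2 + b * w3) -
    (w1 + a * w2 + b * w3 - b * w1 ^+ (p * q) +
     \sum_(m < p) a ^+ m.+1 * \sum_(j < m.+1)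
       c j *+ 'C(q * j.+1 - j, m - j) * w1 ^+ (q * j.+1 - m) * w2 ^+ (m - j))).
Proof.
move=> o1 o2 o3; set s := w1 + _ + _; set S := \sum_(m < p) _.
have ow : order_ge 1 (w1 + a * w2).
  by apply: order_geD o1 _; apply: order_geMl; apply: order_geW o2; lia.
have os : order_ge 1 s.
  by apply: order_geD ow _; apply: order_geMl; apply: order_geW o3; nia.
pose T j := \sum_(m < p | (j <= m)%N)
      w1 ^+ (q * j.+1 - m) * (a * w2) ^+ (m - j) *+ 'C(q * j.+1 - j, m - j).
have -> : S = \sum_(j < p) c j * a ^+ j.+1 * T j.
  rewrite /S; under eq_bigr do rewrite mulr_sumr.
  under [RHS]eq_bigr do rewrite mulr_sumr.
  rewrite [RHS](exchange_big_dep predT) //=; apply: eq_bigr => m _.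
  rewrite (big_ord_widen p (fun j => a ^+ m.+1 * (c j *+ 'C(q * j.+1 - j, m - j) *
     w1 ^+ (q * j.+1 - m) * w2 ^+ (m - j)))) //.
  apply: eq_big => [j|j]; rewrite ltnS // => le_jm.
  by rewrite -{1}(subnK le_jm) -addnS exprD exprMn; apply: collect_powers.
rewrite /inv_series
  (_ : _ - _ = \sum_(j < p) c j * a ^+ j.+1 * (s ^+ (q * j.+1 - j) - T j)
               - b * (s ^+ (p * q) - w1 ^+ (p * q))); last first.
  under [X in _ = X - _]eq_bigr do rewrite mulrBr.
  by rewrite sumrB mulrBr; apply: expand_diff.
apply: order_geB; last first.
  (* As [s - w1] has order at least [q > 1], the difference of the powers has order above [p q]. *)
  apply: order_geMl; apply: (@order_geW _ _ _ (q.-1 + p * q)%N); first by lia.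
  apply: order_ge_subX => //; rewrite prednK ?(leq_trans _ lt_pq) //.
  rewrite /s addrC -(addrA w1) addKr; apply: order_geD; apply: order_geMl => //.
  by apply: order_geW o3; nia.
apply: order_ge_sum => j _; apply: order_geMl.
rewrite -[s ^+ _](subrK ((w1 + a * w2) ^+ (q * j.+1 - j))) -addrA.
apply: order_geD; last exact: binom_trunc.
(* Here [s] and [w1 + a * w2] differ by [b * w3], of order [p q], and the exponent [q * j.+1 - j] is
   at least 2. *)
apply: (@order_geW _ _ _ ((p * q).-1 + (q * j.+1 - j))%N).
  by have := ltn_ord j; nia.
apply: order_ge_subX => //; rewrite prednK ?muln_gt0; last by lia.
by rewrite /s addrC addKr; apply: order_geMl.
Qed.

End Inversion.

(** * Evaluation and specialization of polynomials in the [v_i] *)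

HB.instance Definition _ p :=
  GRing.RMorphism.copy (@zlocal_val p) (val : zlocal p -> rat).

Section MonomialEvaluation.
Variables (I : choiceType) (S : comNzRingType) (v : I -> S).
Implicit Types (m : cmonom I).

Definition cmeval m : S := \prod_(i <- finsupp m) v i ^+ m i.

Lemma cmevalEw m (d : {fset I}) : (finsupp m `<=` d)%fset ->
  cmeval m = \prod_(i <- d) v i ^+ m i.
Proof.
move=> le; rewrite /cmeval (big_fset_incl _ le) // => i _.
by rewrite -cmE_neq0 negbK => /eqP->; rewrite expr0.
Qed.

Lemma cmeval_is_multiplicative : mmorphism cmeval.
Proof.
split=> [m1 m2|]; last by rewrite /cmeval mdom1 big_seq_fset0.
rewrite {1}/cmeval mdomD (cmevalEw (fsubsetUl _ (finsupp m2))).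
rewrite (cmevalEw (fsubsetUr (finsupp m1) _)) -big_split /=.
by apply: eq_bigr => i _; rewrite cmM exprD.
Qed.

HB.instance Definition _ :=
  monalg.isMultiplicative.Build (cmonom I) S cmeval cmeval_is_multiplicative.

Lemma cmevalU i : cmeval (ucm i) = v i.
Proof. by rewrite /cmeval mdomU big_seq_fset1 cmUU expr1. Qed.

End MonomialEvaluation.

(** Induction on the total degree, dividing by a variable of the support. *)
Lemma cmonom_ind (I : choiceType) (P : cmonom I -> Prop) :
  P mone -> (forall i m, P m -> P (mmul (ucm i) m)) -> forall m, P m.
Proof.
move=> P1 PM m; have [d] := ubnP (monalg.mdeg m); elim: d m => // d IH m lt_md.
have [/eqP|d0] := eqVneq (monalg.mdeg m) 0%N.
  by rewrite monalg.mdeg_eq0 => /eqP->.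
have [i mi] : exists i, i \in finsupp m.
  case: (fset_0Vmem (finsupp m)) => [e|[i mi]]; last by exists i.
  by rewrite monalg.mdegE e big_seq_fset0 in d0.
have em : m = mmul (ucm i) (divcm m (ucm i)).
  apply/eqP/cmP=> j; rewrite cmM divcmE cmU.
  by case: eqVneq => [<-|_]; rewrite ?subn0 // subnKC // lt0n cmE_neq0.
rewrite em; apply/PM/IH; move: lt_md; rewrite {1}em monalg.mdegM monalg.mdegU.
by rewrite add1n.
Qed.

Lemma malgU_vconst (K : comNzRingType) (c : K) (m : cmonom nat) :
  mkmalgU m c = vconst c * mkmalgU m 1.
Proof.
rewrite /vconst -scalerAl mul1r; apply/malgP => k.
apply: etrans (monalg.mcoeffU m c k) _.
apply: etrans (esym (monalg.mcoeffZ _ _ _)).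
have e := monalg.mcoeffU m (1 : K) k.
apply: etrans (esym (congr1 (fun x => c * x) e)).
by rewrite mulr_natr.
Qed.

Section Specialization.
Variables (p h : nat).

(** Index [i] stands for [v_(i+1)]; the indeterminate ['X] stands for [u_(h-1)]. *)
Definition spec_var (K : comNzRingType) (i : nat) : {poly K} :=
  if i.+1 == h.-1 then 'X else (i.+1 == h)%:R.

Definition spec (K : comNzRingType) : vpoly K -> {poly K} :=
  monalg.mmap (@polyC K) (cmeval (spec_var K)).

HB.instance Definition _ (K : comNzRingType) :=
  GRing.RMorphism.copy (@spec K) (monalg.mmap (@polyC K) (cmeval (spec_var K))).

Lemma spec_vconst (K : comNzRingType) (c : K) : spec (vconst c) = c%:P.
Proof. by rewrite /spec monalg.mmapZ monalg.mmap1 mulr1. Qed.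

Lemma spec_araki (K : comNzRingType) i : (0 < i)%N ->
  spec (araki p K i) = if i == h.-1 then 'X else (i == h)%:R.
Proof. by case: i => // i _; rewrite /spec monalg.mmapU cmevalU mul1r. Qed.

(** The images of the variables are already defined over Z_(p). This is the source of all
    p-integrality below. *)
Lemma spec_vrat (g : vpoly (zlocal p)) :
  spec (vrat g) = map_poly (@zlocal_val p) (spec g).
Proof.
rewrite /vrat monalg.mmapE rmorph_sum [in RHS]/spec monalg.mmapE rmorph_sum.
apply: eq_bigr => m _; rewrite !rmorphM [in LHS]/= spec_vconst.
congr (_ * _); first by rewrite /= map_polyC.
rewrite [spec _]monalg.mmapU mul1r /cmeval rmorph_prod.
apply: eq_bigr => i _; rewrite rmorphXn /spec_var.
by case: ifP => _; [rewrite /= map_polyX | rewrite rmorph_nat].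
Qed.

End Specialization.

(** * The specialized Araki logarithm *)

Lemma subrX_neq0 (p n : nat) : (1 < p)%N -> (1 < n)%N -> (p%:R - p%:R ^+ n : rat) != 0.
Proof.
move=> p1 n1; rewrite subr_eq0 -natrX eqr_nat neq_ltn -{1}(expn1 p).
by rewrite ltn_exp2l // n1.
Qed.

Section SpecializedLogarithm.
Variables (p h : nat).
Hypotheses (p_gt1 : (1 < p)%N) (h_gt2 : (2 < h)%N).
Variable l : nat -> vpoly rat.
Hypothesis l_araki : araki_log_coefs p l.
Let L i : {poly rat} := spec h (l i).
Let d n : rat := p%:R - p%:R ^+ (p ^ n).

Let dn0 n : (0 < n)%N -> d n != 0.
Proof.
by move=> n0; apply: subrX_neq0 => //; rewrite -(expn0 p) ltn_exp2l.
Qed.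

(** As [v_0 = p], the term [i = n] of Araki's recursion is [l_n p^(p^n)]; it is moved to the
    left. *)
Lemma spec_log_rec n :
  d n *: L n = \sum_(i < n) L i * spec h (araki p rat (n - i)) ^+ (p ^ i).
Proof.
have e : p%:R * L n = \sum_(i < n.+1) L i * spec h (araki p rat (n - i)) ^+ (p ^ i).
  have /(congr1 (@spec h rat)) := l_araki.2 n.
  rewrite rmorphM rmorph_nat rmorph_sum => ->.
  by apply: eq_bigr => i _; rewrite rmorphM rmorphXn.
have s0 : spec h (araki p rat 0) = p%:R by rewrite /araki rmorph_nat.
move: e; rewrite big_ord_recr subnn s0 => e.
rewrite /d scalerBl -mul_polyC polyC_natr e -mul_polyC polyC_exp polyC_natr.
by rewrite [L n * _]mulrC addrK.
Qed.

Lemma spec_log0 : L 0 = 1.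
Proof. by rewrite /L l_araki.1 rmorph1. Qed.

(** Every [v_(i-j)] with [j < i] has index between 1 and [h - 2], hence specializes to 0. *)
Lemma spec_log_lt i : (0 < i < h.-1)%N -> L i = 0.
Proof.
move=> /andP[i0 lt_ih]; apply/eqP; rewrite -[_ == _]orFb -(negPf (dn0 i0)).
rewrite -scaler_eq0 spec_log_rec big1 // => j _.
have ltj := ltn_ord j; have a1 : (0 < i - j)%N by lia.
have a2 : (i - j == h.-1)%N = false by lia.
have a3 : (i - j == h)%N = false by lia.
by rewrite (spec_araki p h rat a1) a2 a3 expr0n gtn_eqF ?mulr0 // expn_gt0 ltnW.
Qed.

Lemma spec_log_pred : L h.-1 = (d h.-1)^-1 *: 'X.
Proof.
have h0 : (0 < h.-1)%N by lia.
apply: (scalerI (dn0 h0)); rewrite scalerA divff ?dn0 // scale1r spec_log_rec.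
case: h h_gt2 h0 (spec_log_lt) => [|[|k]] //= _ _ Llt.
rewrite big_ord_recl subn0 spec_log0 mul1r spec_araki //= eqxx expr1 big1 ?addr0 //.
by move=> i _; rewrite Llt ?mul0r //= ltnS /bump /=; have := ltn_ord i; lia.
Qed.

Lemma spec_logh : L h = ((d h)^-1)%:P.
Proof.
have h0 : (0 < h)%N by lia.
apply: (scalerI (dn0 h0)); rewrite -[RHS]mul_polyC -polyCM divff ?dn0 // spec_log_rec.
case: h h_gt2 h0 (spec_log_lt) => [|[|[|k]]] //= _ _ Llt.
rewrite big_ord_recl subn0 spec_log0 mul1r spec_araki //= eqxx ifF; last by lia.
rewrite expr1 big_ord_recr /= big1 ?add0r => [|i _]; last first.
  by rewrite Llt ?mul0r //= /bump /=; have := ltn_ord i; lia.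
(* The last term is [l_(h-1) v_1^(p^(h-1))], and [v_1] specializes to 0 because [1 < h - 1]. *)
rewrite (_ : (_ - _)%N = 1%N) ?spec_araki //=; last by rewrite /bump; lia.
by rewrite expr0n gtn_eqF ?mulr0 ?addr0 // expn_gt0 ltnW.
Qed.

End SpecializedLogarithm.

(** * The truncated functional equation of the logarithm *)

Lemma fgl_order (A : comNzRingType) (H : series 2 A) : formal_group_law H -> order_ge 1 H.
Proof.
(* In degree 0 the identity [H(t, 0) = t] involves only the constant term of [H], which must
   therefore vanish. *)
case=> /(congr1 (fun f => scoef f 0%MM)) /= e _ _ _ m; rewrite ltnS leqn0 mdeg_eq0.
move=> /eqP->; have d0 : (mdeg (0%MM : 'X_{1..2}) < (mdeg (0%MM : 'X_{1..1})).+1)%N.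
  by rewrite !mdeg0.
have e0 (k : 'X_{1..2 < (mdeg (0%MM : 'X_{1..1})).+1}) : (k == BMultinom d0) = true.
  by case: k => k dk; rewrite bmeqP /= -mdeg_eq0; move: dk; rewrite mdeg0 ltnS leqn0.
move: e; rewrite (big_pred1 (BMultinom d0)) => [|k]; last by rewrite /= e0.
rewrite big1 => [|i _]; last by rewrite mnm0E expr0.
rewrite /= eqxx mulr1 => ->; case: eqP => // /(congr1 mdeg).
by rewrite mdeg0 mdeg1.
Qed.

Lemma subr_truncations (R : comNzRingType) (s s' x y z : R) :
  s - x + (s' - y) - (s + s' - z) = z - x - y.
Proof. ring. Qed.

(** Truncating the three logarithms in [log H = log x + log y] gives a finite identity, which [f]
    transports. *)
Lemma log_map (A B : comNzRingType) (f : {rmorphism A -> B}) p h l (H : series 2 A) :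
  (1 < p)%N -> order_ge 1 H -> is_logarithm (ptypical_series p l) H ->
  order_ge (p ^ h).+1 (\sum_(i < h.+1) (f (l i))%:S *
    (series_map f H ^+ (p ^ i) - svar 1 B 0 ^+ (p ^ i) - svar 1 B 1 ^+ (p ^ i))).
Proof.
move=> p_gt1 H1 [_ _ eL].
have oH := @log_trunc p h A l p_gt1 2 H H1.
have ox := @log_trunc p h A l p_gt1 2 (svar 1 A 0) (order_ge_var A (inord 0)).
have oy := @log_trunc p h A l p_gt1 2 (svar 1 A 1) (order_ge_var A (inord 1)).
have := order_geB (order_geD ox oy) oH; rewrite eL subr_truncations.
move/(order_ge_map f).
set W := _ - _ - _ => oW; suff <- : series_map f W = \sum_(i < h.+1) (f (l i))%:S *
    (series_map f H ^+ (p ^ i) - svar 1 B 0 ^+ (p ^ i) - svar 1 B 1 ^+ (p ^ i)) by [].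
rewrite /W !series_mapB !series_map_sum -!sumrB; apply: eq_bigr => i _.
by rewrite !series_mapM !series_mapX !series_mapC !series_map_var !mulrBr.
Qed.

Lemma sum_sparse (V : nmodType) h (X : nat -> V) : (1 < h)%N ->
  (forall i, (0 < i < h.-1)%N -> X i = 0) ->
  \sum_(i < h.+1) X i = X 0%N + X h.-1 + X h.
Proof.
case: h => [|[|h]] //= _ X0; rewrite big_ord_recr big_ord_recr big_ord_recl /=.
by rewrite big1 ?addr0 // => i _; apply: X0; rewrite /bump /=; have := ltn_ord i; lia.
Qed.

Lemma subr_ACA (R : comNzRingType) (s t u s' t' u' : R) :
  s + t - u - (s' + t' - u') = s - s' + (t - t') - (u - u').
Proof. ring. Qed.

Lemma subr_telescope (R : comNzRingType) (s s' t z : R) :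
  s - s' - (s - z) + (s' - t) = z - t.
Proof. ring. Qed.

(** * Inversion of the truncated logarithm *)

Section InvertLogarithm.
Variables (n : nat) (K : comNzRingType) (p q : nat).
Variables (a b : series n K) (c : nat -> series n K).
Hypotheses (p_gt1 : (1 < p)%N) (lt_pq : (p < q)%N).
Hypothesis sum_c : forall m,
  \sum_(j < m.+1) c j *+ 'C(q * j.+1 - j, m - j) = - (m == 0%N)%:R.
Implicit Types s w z : series n K.

Lemma inv_series_congr s s' : order_ge 1 s -> order_ge 1 s' ->
  order_ge (p * q).+1 (s - s') ->
  order_ge (p * q).+1 (inv_series p q a b c s - inv_series p q a b c s').
Proof.
move=> os os' oss.
have oX k : (0 < k)%N -> order_ge (p * q).+1 (s ^+ k - s' ^+ k).
  move=> k0; apply: (@order_geW _ _ _ (p * q + k)%N); first by lia.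
  exact: order_ge_subX.
rewrite /inv_series subr_ACA -sumrB -mulrBr.
apply: order_geB; last by apply: order_geMl; apply: oX; rewrite muln_gt0; lia.
apply: order_geD oss _; apply: order_ge_sum => j _; rewrite -mulrBr.
by apply: order_geMl; apply: oX; have := ltn_ord j; nia.
Qed.

(** When the [w] are powers of [z], the term for [m] and [j] is a multiple of [z^(q(m+1)-m)], a
    power independent of [j]; by [sum_c] the double sum reduces to [- a z^q]. *)
Lemma inv_series_log z : order_ge 1 z ->
  order_ge (p * q).+1 (inv_series p q a b c (z + a * z ^+ q + b * z ^+ (p * q)) - z).
Proof.
move=> oz; have := inv_series_expand a b c p_gt1 lt_pq oz (order_geXn oz) (order_geXn oz).
set S := \sum_(m < p) _; suff -> : S = - (a * z ^+ q).
  by rewrite addrAC addrK addrAC addrK.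
rewrite /S; transitivity
  (\sum_(m < p) a ^+ m.+1 * (- (m == 0%N :> nat)%:R * z ^+ (q * m.+1 - m))).
  apply: eq_bigr => m _; congr (_ * _); rewrite -sum_c mulr_suml; apply: eq_bigr => j _.
  rewrite -mulrA -exprM -exprD; congr (_ * z ^+ _).
  by have := ltn_ord m; have := ltn_ord j; nia.
case: p p_gt1 => // p' _; rewrite big_ord_recl big1 => [|i _]; last first.
  by rewrite /= oppr0 mul0r mulr0.
by rewrite /= expr1 muln1 subn0 addr0 mulN1r mulrN.
Qed.

(** The truncated inverse is applied to both sides: it takes the logarithm of [z] back to [z], and
    the other side to its explicit expansion. *)
Lemma log_inversion z w1 w2 w3 :
  order_ge 1 z -> order_ge 1 w1 -> order_ge q w2 -> order_ge (p * q) w3 ->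
  order_ge (p * q).+1 (z + a * z ^+ q + b * z ^+ (p * q) - (w1 + a * w2 + b * w3)) ->
  order_ge (p * q).+1 (z -
    (w1 + a * w2 + b * w3 - b * w1 ^+ (p * q) +
     \sum_(m < p) a ^+ m.+1 * \sum_(j < m.+1)
       c j *+ 'C(q * j.+1 - j, m - j) * w1 ^+ (q * j.+1 - m) * w2 ^+ (m - j))).
Proof.
move=> oz o1 o2 o3 oe; have q0 : (0 < q)%N by lia.
have oq w d : (0 < d)%N -> order_ge d w -> order_ge 1 w by apply: order_geW.
have olog z1 z2 z3 : order_ge 1 z1 -> order_ge q z2 -> order_ge (p * q) z3 ->
    order_ge 1 (z1 + a * z2 + b * z3).
  move=> h1 /(oq _ _ q0) h2 /(oq _ (p * q)%N) h3.
  do 2?apply: order_geD => //; apply: order_geMl => //.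
  by apply: h3; rewrite muln_gt0; lia.
have e1 := inv_series_log oz.
have e2 := inv_series_expand a b c p_gt1 lt_pq o1 o2 o3.
have olz := olog _ _ _ oz (order_geXn oz) (order_geXn oz).
have e3 := inv_series_congr olz (olog _ _ _ o1 o2 o3) oe.
have := order_geD (order_geB e3 e1) e2.
by rewrite subr_telescope.
Qed.

End InvertLogarithm.

(** * The expansion over Q[u] *)

(** The formula of the theorem over any ring, to be carried between Q[u], Z_(p)[u] and the
    deformation ring. *)
Definition expansion (K : comNzRingType) p (u : K)
    (A B : series 2 K) (P : nat -> series 2 K) :=
  svar 1 K 0 + svar 1 K 1 - u%:S * A - B + \sum_(1 <= m < p) (u ^+ m.+1)%:S * P m.

Lemma expansion_map (K L : comNzRingType) (f : {rmorphism K -> L}) p u A B P :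
  series_map f (expansion p u A B P) =
  expansion p (f u) (series_map f A) (series_map f B) (fun m => series_map f (P m)).
Proof.
rewrite series_mapD !series_mapB series_mapD series_mapM series_mapC !series_map_var.
rewrite series_map_sum; congr (_ + _); apply: eq_bigr => m _.
by rewrite series_mapM series_mapC rmorphXn.
Qed.

Lemma subr_log (R : comNzRingType) (z x y zq xq yq zN xN yN a b : R) :
  z - x - y + a * (zq - xq - yq) + b * (zN - xN - yN) =
  z + a * zq + b * zN - (x + y + a * (xq + yq) + b * (xN + yN)).
Proof. ring. Qed.

Lemma expansion_regroup (R : comNzRingType) (w xq yq xN yN wq wN a b t : R) :
  w + a * (xq + yq) + b * (xN + yN) - b * wN + (a * - wq + t) =
  w - a * (wq - xq - yq) - b * (wN - xN - yN) + t.
Proof. ring. Qed.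

Section RationalExpansion.
Variables (p h : nat).
Hypotheses (hp : prime p) (hh : (2 < h)%N).
Let q := (p ^ h.-1)%N.
Let p_gt1 := prime_gt1 hp.
Let K : comNzRingType := {poly rat}.
Let d n : rat := p%:R - p%:R ^+ (p ^ n).
Let x := svar 1 K 0.
Let y := svar 1 K 1.
Let a : series 2 K := ((d h.-1)^-1 *: 'X : K)%:S.
Let b : series 2 K := (((d h)^-1)%:P : K)%:S.
Let c j : series 2 K := ((inv_coef q j)%:P : K)%:S.

Let pq : (p ^ h = p * q)%N.
Proof. by rewrite /q -expnS prednK //; lia. Qed.

Let lt_pq : (p < q)%N.
Proof. by rewrite /q -{1}(expn1 p) ltn_exp2l //; lia. Qed.

Let sum_c m : \sum_(j < m.+1) c j *+ 'C(q * j.+1 - j, m - j) = - (m == 0%N)%:R.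
Proof.
transitivity
  (((\sum_(j < m.+1) inv_coef q j * 'C(q * j.+1 - j, m - j)%:R)%:P : K)%:S : series 2 K).
  rewrite !rmorph_sum; apply: eq_bigr => j _.
  by rewrite -!rmorphMn mulr_natr.
by rewrite sum_inv_coef !rmorphN !rmorph_nat.
Qed.

(** The factor [1/p] of [Cpoly] is absorbed through [p (1 - p^(p^n-1)) = p - p^(p^n)]. *)
Lemma map_Cpoly n : series_map (@polyC rat) (((1 - p%:R ^+ (p ^ n - 1))^-1)%:S * Cpoly p n) =
  (((d n)^-1)%:P : K)%:S * ((x + y) ^+ (p ^ n) - x ^+ (p ^ n) - y ^+ (p ^ n)).
Proof.
rewrite series_mapM series_mapC /Cpoly series_mapM series_mapC !series_mapB !series_mapX.
rewrite series_mapD !series_map_var mulrA -rmorphM -rmorphM -invfM; congr ((_^-1)%:P%:S * _).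
by rewrite mulrBl mul1r -exprSr -subSn ?subn1 // expn_gt0 ltnW.
Qed.

(** Here [a] is ['X / (p - p^q)], and [j (q - 1) + q = q (j + 1) - j] matches the second binomial
    coefficients. *)
Lemma map_Ppoly m : (m < p)%N ->
  (('X : K) ^+ m.+1)%:S * series_map (@polyC rat) (Ppoly p h m) =
  a ^+ m.+1 * \sum_(j < m.+1)
     c j *+ 'C(q * j.+1 - j, m - j) * (x + y) ^+ (q * j.+1 - m) * (x ^+ q + y ^+ q) ^+ (m - j).
Proof.
move=> lt_mp; rewrite /Ppoly series_mapM series_mapC series_map_sum mulrA; congr (_ * _).
  have -> : a ^+ m.+1 = ((d h.-1 ^- m.+1)%:P * 'X ^+ m.+1 : K)%:S.
    by rewrite /a -(rmorphXn (@series_const 2 K)) /= exprZn exprVn -mul_polyC.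
  by rewrite -rmorphM mulrC.
apply: eq_bigr => j _; rewrite !series_mapM series_mapC.
rewrite !series_mapX !series_mapD !series_mapX !series_map_var.
congr (_ * _ * _); rewrite /c -!rmorphMn mulr_natr; congr ((_ *+ 'C(_, _))%:P%:S).
by have := ltn_ord j; rewrite mulnBr mulnS; nia.
Qed.

(** [log_inversion] with [w1 = x + y], [w2 = x^q + y^q] and [w3 = x^(pq) + y^(pq)]: then
    [w1 + a w2 + b w3] is the truncated [log x + log y]. *)
Lemma rational_expansion (G : series 2 (vpoly (zlocal p))) : universal_ptypical G ->
  order_ge (p ^ h).+1 (series_map (@spec h rat) (series_map (@vrat p) G) -
    expansion p ('X : K)
      (series_map (@polyC rat) (((1 - p%:R ^+ (p ^ h.-1 - 1))^-1)%:S * Cpoly p h.-1))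
      (series_map (@polyC rat) (((1 - p%:R ^+ (p ^ h - 1))^-1)%:S * Cpoly p h))
      (fun m => series_map (@polyC rat) (Ppoly p h m))).
Proof.
case=> fG [l la lG].
have oG : order_ge 1 (series_map (@vrat p) G).
  move=> m md; rewrite /= (fgl_order fG md) /vrat monalg.mmapE monalg.msupp0.
  exact: big_seq_fset0.
have oz := @order_ge_map 2 _ _ (@spec h rat) _ _ oG.
have := @log_map _ _ (@spec h rat) p h l _ p_gt1 oG lG.
set z := series_map (@spec h rat) _ in oz *.
pose T i := (spec h (l i))%:S * (z ^+ (p ^ i) - x ^+ (p ^ i) - y ^+ (p ^ i)).
rewrite (@sum_sparse _ h T); [|lia|]; last first.
  by move=> i hi; rewrite /T (spec_log_lt p_gt1 hh la) // rmorph0 mul0r.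
rewrite /T (spec_log0 h la) (spec_log_pred p_gt1 hh la) (spec_logh p_gt1 hh la).
rewrite rmorph1 mul1r expn0 !expr1 -/(d _) -/(d _) -/a -/b -/q pq subr_log => e.
have ox : order_ge 1 x by apply: order_ge_var.
have oy : order_ge 1 y by apply: order_ge_var.
have := log_inversion p_gt1 lt_pq sum_c oz (order_geD ox oy)
  (order_geD (order_geXn ox) (order_geXn oy)) (order_geD (order_geXn ox) (order_geXn oy)) e.
set F := expansion _ _ _ _ _; suff -> : F = x + y + a * (x ^+ q + y ^+ q) +
  b * (x ^+ (p * q) + y ^+ (p * q)) - b * (x + y) ^+ (p * q) +
  \sum_(m < p) a ^+ m.+1 * \sum_(j < m.+1) c j *+ 'C(q * j.+1 - j, m - j) *
     (x + y) ^+ (q * j.+1 - m) * (x ^+ q + y ^+ q) ^+ (m - j) by [].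
rewrite -(big_mkord predT (fun m => a ^+ m.+1 * \sum_(j < m.+1)
  c j *+ 'C(q * j.+1 - j, m - j) * (x + y) ^+ (q * j.+1 - m) * (x ^+ q + y ^+ q) ^+ (m - j))).
(* The term [m = 0] is [- a (x + y)^q]; together with [a (x^q + y^q)] it gives the term with
   [Cpoly p h.-1]. *)
rewrite big_ltn; last by lia.
rewrite big_ord1 expr1 muln1 !subn0 bin0 mulr1n expr0 mulr1.
have -> : c 0 = -1 by rewrite /c /inv_coef bin0 expr1 divr1 mulr1 !rmorphN1.
rewrite mulN1r expansion_regroup /F /expansion; congr (_ - _ - _ + _).
- by rewrite map_Cpoly mulrA -series_constM [_ * (_%:P)]mulrC mul_polyC.
- by rewrite -pq map_Cpoly.
by apply: eq_big_nat => m /andP[_ lt_mp]; rewrite map_Ppoly.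
Qed.

End RationalExpansion.

(** * Ideals and their powers *)

Section IdealSpan.
Variable A : comNzRingType.
Implicit Types (S I : A -> Prop) (z : A).

Definition is_ideal I :=
  [/\ I 0, forall a b, I a -> I b -> I (a + b) & forall r a, I a -> I (r * a)].

Lemma ideal_sum I (T : Type) (r : seq T) (P : pred T) (F : T -> A) :
  is_ideal I -> (forall i, P i -> I (F i)) -> I (\sum_(i <- r | P i) F i).
Proof. by case=> I0 ID _ FI; elim/big_ind: _. Qed.

Lemma ideal_span_ideal S : is_ideal (ideal_span S).
Proof.
split=> [|a b [n1 [c1 [s1 [S1 ->]]]] [n2 [c2 [s2 [S2 ->]]]]|r a [n [c [s [Ss ->]]]]].
- by exists 0%N, (fun=> 0), (fun=> 0); split=> [[]|]; rewrite ?big_ord0.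
- exists (n1 + n2)%N, (fun i => match split i with inl j => c1 j | inr j => c2 j end),
    (fun i => match split i with inl j => s1 j | inr j => s2 j end); split.
    by move=> i; case: (split i).
  rewrite big_split_ord; congr (_ + _); apply: eq_bigr => i _.
    by rewrite (unsplitK (inl i)).
  by rewrite (unsplitK (inr i)).
exists n, (fun i => r * c i), s; split=> //; rewrite mulr_sumr.
by apply: eq_bigr => i _; rewrite mulrA.
Qed.

Lemma ideal_span_gen S z : S z -> ideal_span S z.
Proof. by move=> Sz; exists 1%N, (fun=> 1), (fun=> z); rewrite big_ord1 mul1r. Qed.

Lemma ideal_exp0 I z : ideal_exp I 0 z.
Proof.
have [_ _ IM] := ideal_span_ideal
  (fun z => exists2 t : 'I_0 -> A, forall i, I (t i) & z = \prod_i t i).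
rewrite -[z]mulr1; apply/IM/ideal_span_gen; exists (fun=> 0); first by case.
by rewrite big_ord0.
Qed.

Lemma ideal_expS I N t z : I t -> ideal_exp I N z -> ideal_exp I N.+1 (t * z).
Proof.
move=> It [n [c [s [Ss ->]]]]; rewrite mulr_sumr; apply: ideal_sum => [|i _].
  exact: ideal_span_ideal.
have [_ _ IM] := ideal_span_ideal
  (fun z => exists2 t : 'I_N.+1 -> A, forall i, I (t i) & z = \prod_i t i).
rewrite mulrCA; apply/IM/ideal_span_gen; have [t' It' ->] := Ss i.
exists (fun j => oapp t' t (unlift ord0 j)) => [j|]; first by case: unliftP => [k|] _ /=.
by rewrite big_ord_recl unlift_none; congr (_ * _); apply: eq_bigr => j _; rewrite liftK.
Qed.

End IdealSpan.

Section SeriesIdeals.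
Variable R : comNzRingType.
Let x := svar 1 R 0.
Let y := svar 1 R 1.
Implicit Types f : series 2 R.

(** Induction on [N]: a series of order [N + 1] is [x f0 + y f1] with [f0] and [f1] of order [N]. *)
Lemma order_ge_exp N f : order_ge N f ->
  ideal_exp (ideal_span (fun t => t = x \/ t = y)) N f.
Proof.
elim: N f => [|N IH] f oN; first exact: ideal_exp0.
pose i0 : 'I_2 := inord 0; pose i1 : 'I_2 := inord 1.
(* [f0] takes the monomials divisible by [x] and [f1] the pure powers of [y], so that none is
   counted twice. *)
pose f0 : series 2 R := Series (fun m => scoef f (m + U_(i0))%MM).
pose f1 : series 2 R := Series (fun m => if m i0 == 0%N then scoef f (m + U_(i1))%MM else 0).
have i01 : (i1 == i0) = false by rewrite /eq_op /= !inordK.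
have -> : f = x * f0 + y * f1.
  apply: seriesP => m; rewrite scoefD !scoef_varM -/i0 -/i1.
  have sU i : (m i == 0%N) = false -> (m - U_(i) + U_(i))%MM = m.
    by move=> mi; apply: submK; rewrite lep1mP mi.
  case: ifPn => [/eqP m0|/negPf m0]; case: ifPn => [/eqP m1|/negPf m1]; rewrite /= ?sU //.
  - rewrite oN ?addr0 // mdegE big1 // => i _.
    have [->|->] // : i = i0 \/ i = i1.
    by case: i => -[|[|//]] hi; [left|right]; apply: val_inj; rewrite /= inordK.
  - by rewrite mnmBE mnm1E i01 subn0 m0 eqxx add0r.
  - by rewrite addr0.
  by rewrite mnmBE mnm1E i01 subn0 m0 addr0.
have [_ ID _] := ideal_span_ideal (fun z => exists2 t : 'I_N.+1 -> series 2 R,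
  forall i, ideal_span (fun t => t = x \/ t = y) (t i) & z = \prod_i t i).
apply: ID; apply: ideal_expS.
- by apply: ideal_span_gen; left.
- by apply: IH => m lt_m /=; apply: oN; rewrite mdegD mdeg1 addn1.
- by apply: ideal_span_gen; right.
by apply: IH => m lt_m /=; case: ifP => // _; apply: oN; rewrite mdegD mdeg1 addn1.
Qed.

(** Removing the finitely many monomials of degree below [N] leaves a series of order [N], so
    membership is tested on constants. *)
Lemma ideal_low_coefs (J : series 2 R -> Prop) N f : is_ideal J ->
  (forall g, order_ge N g -> J g) ->
  (forall m, (mdeg m < N)%N -> J (scoef f m)%:S) -> J f.
Proof.
move=> idJ JN Jf; have [_ JD JM] := idJ.
pose mono (k : 'X_{1..2}) : series 2 R := Series (fun m => (m == k)%:R).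
pose g := \sum_(k : 'X_{1..2 < N}) (scoef f k)%:S * mono k.
rewrite -[f](subrK g); apply: JD; last first.
  by apply: ideal_sum => // k _; rewrite mulrC; apply/JM/Jf/bmdeg.
apply: JN => m lt_m; rewrite scoefB scoef_sum (eq_bigr _ (fun k _ => scoefCM _ _ _)).
rewrite (bigD1 (BMultinom lt_m)) //= eqxx mulr1 big1 ?addr0 ?subrr // => k.
by rewrite bmeqP eq_sym => /negPf /= ->; rewrite mulr0.
Qed.

End SeriesIdeals.

(** * Congruence of ring maps out of Z_(p)[v_1, v_2, ...] *)

Lemma subr_mulD (R : comNzRingType) (a b a' b' : R) :
  a * b - a' * b' = a * (b - b') + b' * (a - a').
Proof. ring. Qed.

(** By [subr_mulD] the congruence passes from variables to monomials, then to linear combinations,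
    as coefficients have equal images. *)
Lemma vpoly_congr (p : nat) (R : comNzRingType) (I : R -> Prop)
    (phi psi : {rmorphism vpoly (zlocal p) -> R}) : is_ideal I ->
  (forall c, phi (vconst c) = psi (vconst c)) ->
  (forall i, I (phi (araki p _ i.+1) - psi (araki p _ i.+1))) ->
  forall g, I (phi g - psi g).
Proof.
move=> idI ec eU g; have [I0 ID IM] := idI.
have em m : I (phi (mkmalgU m 1) - psi (mkmalgU m 1)).
  elim/cmonom_ind: m => [|i m IH]; first by rewrite !rmorph1 subrr.
  have -> : mkmalgU (mmul (ucm i) m) 1 = araki p (zlocal p) i.+1 * mkmalgU m 1.
    rewrite /araki; apply: esym; apply: etrans (malgM_def _ _) _.
    by apply: etrans (fgmulUU _ _ _ _) _; rewrite mulr1.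
  by rewrite !rmorphM subr_mulD; apply: ID (IM _ _ IH) (IM _ _ (eU i)).
rewrite [g]monalgE !rmorph_sum -sumrB; apply: ideal_sum => // m _.
by rewrite malgU_vconst !rmorphM ec -mulrBr; apply: IM.
Qed.

(** * Degree bounds and p-integrality *)

Lemma Cpoly_degree p n : degree_le (p ^ n) (Cpoly p n).
Proof.
have X_le (i : nat) : degree_le (p ^ n) (svar 1 rat i ^+ (p ^ n)).
  by rewrite -[X in degree_le X]mul1n; apply/degree_leX/degree_le_var.
apply: degree_leCM; do 2!apply: degree_leB => //.
rewrite -[X in degree_le X]mul1n; apply: degree_leX.
by apply: degree_leD; apply: degree_le_var.
Qed.

(** Each term has degree at most [q (m + 1) - m <= p q]. With this bound, integrality in degrees up
    to [p^h] suffices. *)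
Lemma Ppoly_degree p h m : (1 < p)%N -> (2 < h)%N -> (m < p)%N ->
  degree_le (p ^ h) (Ppoly p h m).
Proof.
move=> p_gt1 hh lt_mp; apply: degree_leCM; apply: degree_le_sum => j _.
have pq : (p ^ h = p * p ^ h.-1)%N by rewrite -expnS prednK //; lia.
have lt_pq : (p < p ^ h.-1)%N by rewrite -{1}(expn1 p) ltn_exp2l //; lia.
rewrite -mulrA pq; apply: degree_leCM; move: (p ^ h.-1)%N lt_pq => q lt_pq.
have X_le (i : nat) : degree_le q (svar 1 rat i ^+ q).
  by rewrite -[X in degree_le X]mul1n; apply/degree_leX/degree_le_var.
apply: (@degree_leW _ _ _ (1 * (q * j.+1 - m) + q * (m - j))%N).
  by have := ltn_ord j; nia.
apply: degree_leM; apply: degree_leX.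
  by apply: degree_leD; apply: degree_le_var.
by apply: degree_leD; apply: X_le.
Qed.

Lemma scoef_expansion (K : comNzRingType) p (A B : series 2 K) (P : nat -> series 2 K) k :
  scoef (expansion p ('X : {poly K}) (series_map (@polyC K) A) (series_map (@polyC K) B)
           (fun m => series_map (@polyC K) (P m))) k =
  ((k == U_(inord 0)%MM) + (k == U_(inord 1)%MM))%:R%:P - 'X * (scoef A k)%:P - (scoef B k)%:P
    + \sum_(1 <= m < p) 'X ^+ m.+1 * (scoef (P m) k)%:P.
Proof.
rewrite scoefD !scoefB scoefD scoefCM scoef_sum natrD polyCD !polyC_natr.
by congr (_ + _); apply: eq_bigr => m _; rewrite scoefCM.
Qed.

(** Powers of [u] separate the ingredients: [B] sits in degree 0, [A] in degree 1 and [P_m] in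
    degree [m + 1]. *)
Lemma coef_expansion (K : comNzRingType) p (e : nat) (a b : K) (c : nat -> K) i :
  (e%:R%:P - 'X * a%:P - b%:P + \sum_(1 <= m < p) 'X ^+ m.+1 * (c m)%:P)`_i =
  (e%:R - b) *+ (i == 0%N) - a *+ (i == 1%N) + c i.-1 *+ (1 < i <= p)%N.
Proof.
rewrite !coefD !coefN coefXM !coefC coef_sum.
have -> : \sum_(1 <= m < p) ('X ^+ m.+1 * (c m)%:P)`_i = c i.-1 *+ (1 < i <= p)%N.
  under eq_bigr do rewrite coefMC coefXn.
  case: i => [|i]; first by rewrite big1 // => m _; rewrite mul0r.
  rewrite (eq_bigr (fun m => if m == i then c m else 0)) => [|m _]; last first.
    by rewrite eqSS eq_sym; case: eqP => _; rewrite ?mul1r ?mul0r.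
  by rewrite -big_mkcond big_nat1_eq ltnS; case: ifP.
by case: i => [|[|i]] /=; rewrite ?eqxx ?mulr0n ?mulr1n ?oppr0 ?subr0 ?addr0 ?add0r ?sub0r.
Qed.

(** Coefficients outside Z_(p) get the default value 0; [zliftK] shows that p-integral series are
    truly lifted. *)
Definition zlift p (f : series 2 rat) : series 2 (zlocal p) :=
  series_map (insubd (0 : zlocal p)) f.

Lemma zliftK p (f : series 2 rat) : (forall k, scoef f k \in plocal p) ->
  series_map (@zlocal_val p) (zlift p f) = f.
Proof. by move=> pf; apply: seriesP => k; apply: insubdK; apply: pf. Qed.

Lemma order_ge_poly_inj p d (D : series 2 {poly zlocal p}) :
  order_ge d (series_map (map_poly (@zlocal_val p)) D) -> order_ge d D.
Proof.
move=> oD m md; apply/polyP => i; apply: val_inj.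
have /(congr1 (fun f : {poly rat} => f`_i)) := oD m md.
by rewrite /= coef_map !coef0.
Qed.

Lemma eq_expansion (K : comNzRingType) p (u : K) A A' B B' P P' :
  A = A' -> B = B' -> (forall m, (1 <= m <= p - 1)%N -> P m = P' m) ->
  expansion p u A B P = expansion p u A' B' P'.
Proof.
move=> -> -> eP; congr (_ + _); apply: eq_big_nat => m hm.
by rewrite eP //; lia.
Qed.

Section Integral.
Variables (p h : nat).
Hypotheses (hp : prime p) (hh : (2 < h)%N).
Variable G : series 2 (vpoly (zlocal p)).
Hypothesis hG : universal_ptypical G.
Let p_gt1 := prime_gt1 hp.
Let AQ := ((1 - p%:R ^+ (p ^ h.-1 - 1))^-1)%:S * Cpoly p h.-1.
Let BQ := ((1 - p%:R ^+ (p ^ h - 1))^-1)%:S * Cpoly p h.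

Lemma spec_vrat_series : series_map (@spec h rat) (series_map (@vrat p) G) =
  series_map (map_poly (@zlocal_val p)) (series_map (@spec h (zlocal p)) G).
Proof. by apply: seriesP => k; rewrite /= spec_vrat. Qed.

(** Up to degree [p^h] the expansion agrees with the specialization of [G], whose coefficients come
    from Z_(p)[u]. *)
Lemma expansion_integral k i : (mdeg k < (p ^ h).+1)%N ->
  (((k == U_(inord 0)%MM) + (k == U_(inord 1)%MM))%:R - scoef BQ k) *+ (i == 0%N)
   - scoef AQ k *+ (i == 1%N) + scoef (Ppoly p h i.-1) k *+ (1 < i <= p)%N \in plocal p.
Proof.
move=> dk; have /(_ k dk) := rational_expansion hp hh hG.
rewrite scoefB scoef_expansion -/AQ -/BQ => /eqP; rewrite subr_eq0 => /eqP e.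
rewrite -(coef_expansion p _ _ _ (fun m => scoef (Ppoly p h m) k)) -e spec_vrat_series.
by rewrite /= coef_map; apply: valP.
Qed.

(** The coefficient of [u^1] in [expansion_integral]; beyond degree [p^h] the series is zero. The
    next two lemmas use [u^0] and [u^(m+1)]. *)
Lemma A_integral k : scoef AQ k \in plocal p.
Proof.
have [dk|dk] := ltnP (mdeg k) (p ^ h).+1.
  have := expansion_integral 1 dk.
  by rewrite /= mulr0n add0r addr0 rpredN.
rewrite (degree_leCM _ (degree_leW _ (@Cpoly_degree p h.-1)) dk) ?rpred0 //.
by rewrite leq_exp2l //; lia.
Qed.

Lemma B_integral k : scoef BQ k \in plocal p.
Proof.
have [dk|dk] := ltnP (mdeg k) (p ^ h).+1; last first.
  by rewrite (degree_leCM _ (@Cpoly_degree p h) dk) rpred0.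
have := expansion_integral 0 dk.
by rewrite /= subr0 addr0 mulr1n rpredBl ?rpred_nat.
Qed.

Lemma P_integral m k : (1 <= m <= p - 1)%N -> scoef (Ppoly p h m) k \in plocal p.
Proof.
move=> hm; have [dk|dk] := ltnP (mdeg k) (p ^ h).+1; last first.
  by rewrite (Ppoly_degree p_gt1 hh _ dk) ?rpred0 //; lia.
have := expansion_integral m.+1 dk; rewrite /= (_ : (1 < m.+1 <= p)%N); last by lia.
by rewrite (_ : m.+1 == 1%N = false) ?subrr ?add0r //; lia.
Qed.

(** The congruence over Q[u] descends, since Z_(p)[u] embeds there and the series have integral
    lifts. *)
Lemma integral_expansion :
  order_ge (p ^ h).+1 (series_map (@spec h (zlocal p)) G -
    expansion p ('X : {poly zlocal p})
      (series_map (@polyC _) (zlift p AQ)) (series_map (@polyC _) (zlift p BQ))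
      (fun m => series_map (@polyC _) (zlift p (Ppoly p h m)))).
Proof.
apply: order_ge_poly_inj; rewrite series_mapB expansion_map /= map_polyX -spec_vrat_series.
have := rational_expansion hp hh hG.
have ePC f : (forall k, scoef f k \in plocal p) ->
    series_map (map_poly (@zlocal_val p)) (series_map (@polyC _) (zlift p f)) =
    series_map (@polyC rat) f.
  move=> pf; rewrite -{2}(zliftK pf); apply: seriesP => k.
  by rewrite /= map_polyC.
have eP m : (1 <= m <= p - 1)%N -> _ := fun hm => ePC _ (fun k => P_integral k hm).
by rewrite (eq_expansion 'X (ePC _ A_integral) (ePC _ B_integral) eP).
Qed.

End Integral.

(** * Transfer to the deformation ring *)

Theorem theorem3p10 (p h : nat) (hp : prime p) (hh : (2 < h)%N)
    (k : finFieldType) (hk : #|k| = (p ^ h)%N)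
    (phi : {rmorphism vpoly (zlocal p) -> series h.-1 (witt hp k)})
    (phi_lt : forall i, (0 < i < h)%N -> phi (araki p _ i) = defparam h _ i)
    (phi_h : phi (araki p _ h) = 1)
    (phi_gt : forall i, (h < i)%N -> phi (araki p _ i) = 0)
    (G : series 2 (vpoly (zlocal p))) (hG : universal_ptypical G) :
  let R : comNzRingType := series h.-1 (witt hp k) in
  let F : series 2 R := series_map phi G in
  let u i : R := defparam h _ i in
  let x := svar 1 R 0 in
  let y := svar 1 R 1 in
  let toQ (f : series 2 (zlocal p)) := series_map (@zlocal_val p) f in
  let toR (f : series 2 (zlocal p)) : series 2 R :=
    series_map (fun c => phi (vconst c)) f in
  let J := ideal_span (fun z : series 2 R =>
             (exists2 i, (0 < i < h.-1)%N & z = (u i)%:S) \/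
             ideal_exp (ideal_span (fun t => t = x \/ t = y)) (p ^ h).+1 z) in
  (* A, B and P m are the rational series below, which are p-integral, read over Z_(p) *)
  exists (A B : series 2 (zlocal p)) (P : nat -> series 2 (zlocal p)),
    [/\ toQ A = ((1 - p%:R ^+ (p ^ h.-1 - 1))^-1)%:S * Cpoly p h.-1,
        toQ B = ((1 - p%:R ^+ (p ^ h - 1))^-1)%:S * Cpoly p h,
        forall m, (1 <= m <= p - 1)%N -> toQ (P m) = Ppoly p h m &
        J (F - (x + y - (u h.-1)%:S * toR A - toR B
                + \sum_(1 <= m < p) (u h.-1 ^+ m.+1)%:S * toR (P m)))].
Proof.
move=> R F u x y toQ toR J.
exists (zlift p (((1 - p%:R ^+ (p ^ h.-1 - 1))^-1)%:S * Cpoly p h.-1)).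
exists (zlift p (((1 - p%:R ^+ (p ^ h - 1))^-1)%:S * Cpoly p h)).
exists (fun m => zlift p (Ppoly p h m)); split.
- by apply: zliftK => m; apply: (A_integral hp hh hG).
- by apply: zliftK => m; apply: (B_integral hp hh hG).
- by move=> m hm; apply: zliftK => e; apply: (P_integral hp hh hG).
(* [fc] is the structure map from Z_(p), [theta] sends ['X] to [u_(h-1)], and [psi] agrees with
   [phi] on the variables except that it kills [v_1, ..., v_(h-2)]. *)
pose fc : {rmorphism zlocal p -> R} :=
  GRing.RMorphism.clone _ _ (phi \o in_alg (vpoly (zlocal p))) _.
pose theta : {rmorphism {poly zlocal p} -> R} :=
  GRing.RMorphism.clone _ _ (horner_eval (u h.-1) \o map_poly fc) _.
pose psi : {rmorphism vpoly (zlocal p) -> R} :=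
  GRing.RMorphism.clone _ _ (theta \o @spec h (zlocal p)) _.
have thetaC c : theta c%:P = phi (vconst c).
  by rewrite /theta /= map_polyC /= /horner_eval hornerC.
have thetaX : theta 'X = u h.-1 by rewrite /theta /= map_polyX /horner_eval hornerX.
have idJ : is_ideal J by apply: ideal_span_ideal.
have [J0 JD JM] := idJ.
apply: (@ideal_low_coefs R J (p ^ h).+1) => // [g og|m dm].
  by apply: ideal_span_gen; right; apply: order_ge_exp.
have Eu : series_map theta (expansion p ('X : {poly zlocal p})
    (series_map (@polyC _) (zlift p (((1 - p%:R ^+ (p ^ h.-1 - 1))^-1)%:S * Cpoly p h.-1)))
    (series_map (@polyC _) (zlift p (((1 - p%:R ^+ (p ^ h - 1))^-1)%:S * Cpoly p h)))
    (fun m => series_map (@polyC _) (zlift p (Ppoly p h m)))) =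
  expansion p (u h.-1) (toR (zlift p (((1 - p%:R ^+ (p ^ h.-1 - 1))^-1)%:S * Cpoly p h.-1)))
    (toR (zlift p (((1 - p%:R ^+ (p ^ h - 1))^-1)%:S * Cpoly p h)))
    (fun m => toR (zlift p (Ppoly p h m))).
  have thetaS f : series_map theta (series_map (@polyC _) f) = toR f.
    by apply: seriesP => e; apply: thetaC.
  by rewrite expansion_map thetaX !thetaS; apply: eq_expansion => // e _; apply: thetaS.
(* Up to degree [p^h] the claimed formula is the image of [G] under [psi], so it remains to compare
   [phi] with [psi] on one coefficient of [G]. *)
have := order_ge_map theta (integral_expansion hp hh hG); rewrite series_mapB Eu.
move=> /(_ m dm) /eqP; rewrite scoefB subr_eq0 => /eqP em.
rewrite scoefB -[X in _ - X]em.
apply: (@vpoly_congr p R (fun c => J c%:S) phi psi) => [|c|i].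
- split=> [|c d Jc Jd|c d Jd]; first by rewrite rmorph0.
    by rewrite series_constD; apply: JD.
  by rewrite series_constM; apply: JM.
- by rewrite /psi /= spec_vconst -thetaC.
rewrite (_ : psi _ = theta (if i.+1 == h.-1 then 'X else (i.+1 == h)%:R)); last first.
  by rewrite -(spec_araki p h (zlocal p) (ltn0Sn i)).
(* Only for [i + 1 < h - 1] can the two maps differ, and then by the generator [u_(i+1)] of [J]. *)
case: (ltngtP i.+1 h.-1) => [lt_i|gt_i|e].
- rewrite (_ : (i.+1 == h) = false) ?rmorph0 ?subr0; last by lia.
  by rewrite phi_lt; [apply: ideal_span_gen; left; exists i.+1; rewrite ?lt_i|lia].
- case: (ltngtP i.+1 h) => [lt_i|lt_i|->]; first by lia.
    by rewrite phi_gt // rmorph0 subrr rmorph0.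
  by rewrite phi_h rmorph1 subrr rmorph0.
by rewrite thetaX phi_lt e ?subrr ?rmorph0 //; lia.
Qed.
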